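(* The harmonic measure $\nu_{\mathrm{h}}$ and the dual harmonic measure $\nu_{\mathrm{h}}^{\dagger}$ are mutually singular.
   Context: For a finite binary string $w=w_1\dots w_n$, its depth is its length $n$ and its horizontal position is $\sum_{j=1}^n w_j2^{-j}\in[0,1)\cong\mathbb{R}/\mathbb{Z}$; the empty string $\varnothing$ has depth $0$ and position $0$. For strings of length $n$, addition of $\pm1$ is modulo $2^n$ (last digit is the units digit), and $w\oplus i$ denotes appending the digit $i$. $\Gamma_{\circ}$ is the (multi)graph on all finite binary strings with edges between $w$ and $w\pm1$ and between $w$ and $w\oplus 0$. At depth $1$ the vertices $0$ and $1$ are joined by two edges, and $\varnothing$ has two loops, each contributing $1$ to its degree. Thus simple random walk on $\Gamma_\circ$ picks uniformly from: add $1$; subtract $1$; append $0$; and, if the string ends in $0$, remove that terminal $0$ (from $\varnothing$: stay put in either of two ways, or append $0$). $\Gamma_{\circ}^{\dagger}$, the wrapped dual graph, is the (multi)graph on all finite binary strings in which simple random walk picks uniformly from: add $1$; subtract $1$; remove the final bit; append $0$; append $1$ (at $\varnothing$ there is no upward move, and adding or subtracting $1$ means staying at $\varnothing$). For simple random walk on $\Gamma_\circ$ (respectively $\Gamma_\circ^\dagger$) started at $\varnothing$, the horizontal positions converge almost surely in $\mathbb{R}/\mathbb{Z}$; the law of the limit, as a probability measure on $[0,1)$, is the harmonic measure $\nu_{\mathrm{h}}$ (respectively $\nu_{\mathrm{h}}^\dagger$). *)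

(* Defs.v *)
From HB Require Import structures.
From mathcomp Require Import all_boot all_order all_algebra.
From mathcomp Require Import all_classical all_reals all_analysis.

Set Implicit Arguments.
Unset Strict Implicit.
Unset Printing Implicit Defensive.

Import Order.TTheory GRing.Theory Num.Theory.
Import numFieldNormedType.Exports.

Local Open Scope classical_set_scope.
Local Open Scope ring_scope.

(* The binary string w_1 ... w_n is the sequence [:: w_1; ...; w_n], so that
   nth false w j is the digit w_(j+1), and w \oplus i is rcons w i. *)
Notation bstring := (seq bool).

Definition bval (w : bstring) : nat :=
  (\sum_(j < size w) nth false w j * 2 ^ (size w - j.+1))%N.

(* The string of length n representing m modulo 2 ^ n. *)
Definition bits (n m : nat) : bstring :=
  mkseq (fun j => odd (m %/ 2 ^ (n - j.+1))%N) n.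

Definition add1 (w : bstring) : bstring :=
  bits (size w) ((bval w + 1) %% 2 ^ size w)%N.

(* The summand 2 ^ size w makes the truncated subtraction exact. *)
Definition sub1 (w : bstring) : bstring :=
  bits (size w) ((bval w + 2 ^ size w - 1) %% 2 ^ size w)%N.

Definition remove_last (w : bstring) : bstring := take (size w).-1 w.

(* A locally finite multigraph is given by the list, with multiplicities, of the
   neighbours of each vertex. A loop contributing 1 to the degree of w is one
   occurrence of w in its own list. *)
Definition multigraph := bstring -> seq bstring.

(* The default value true of last excludes the empty string from the upward
   moves; on the empty string, add1 and sub1 give the two loops. *)
Definition Gamma : multigraph := fun w =>
  [:: add1 w; sub1 w; rcons w false] ++
  (if last true w then [::] else [:: remove_last w]).

Definition Gamma_dual : multigraph := fun w =>
  [:: add1 w; sub1 w; rcons w false; rcons w true] ++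
  (if w is [::] then [::] else [:: remove_last w]).

Definition step_prob (R : realType) (G : multigraph) (v w : bstring) : R :=
  (count_mem w (G v))%:R / (size (G v))%:R.

(* bstring carries no sigma-algebra here: measurability of X n for the discrete
   one is measurability of the preimages of points, bstring being countable. *)
Definition simple_random_walk (R : realType) (d : measure_display)
    (T : measurableType d) (P : probability T R) (G : multigraph)
    (x0 : bstring) (X : nat -> T -> bstring) : Prop :=
  (forall n w, measurable (X n @^-1` [set w])) /\
  (forall (n : nat) (x : nat -> bstring),
     P [set t | forall k, (k <= n)%N -> X k t = x k] =
     ((x 0%N == x0)%:R *
        \prod_(k < n) step_prob R G (x k) (x k.+1))%:E).

Definition position (R : realType) (w : bstring) : R :=
  \sum_(j < size w) (nth false w j)%:R * 2^-1 ^+ j.+1.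

(* The quotient distance of R/Z, that is, the distance of x - y to the nearest
   integer. *)
Definition circle_dist (R : realType) (x y : R) : R :=
  let t := x - y - (Num.floor (x - y))%:~R in Num.min t (1 - t).

(* nu is the law of the almost sure limit in R/Z, represented in [0, 1), of the
   positions of a simple random walk on G started at the empty string. *)
Definition harmonic_measure (R : realType) (G : multigraph)
    (nu : probability (measurableTypeR R) R) : Prop :=
  exists (d : measure_display) (T : measurableType d) (P : probability T R)
         (X : nat -> T -> bstring) (Z : {RV P >-> measurableTypeR R}),
    [/\ simple_random_walk P G [::] X,
        forall t, 0 <= (Z t : R) < 1,
        {ae P, forall t,
           circle_dist (position R (X n t)) (Z t) @[n --> \oo] --> (0 : R)}
      & forall A : set (measurableTypeR R), measurable A ->
           nu A = distribution P Z A].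

Definition mutually_singular (R : realType) (d : measure_display)
    (T : measurableType d) (mu nu : {measure set T -> \bar R}) : Prop :=
  exists A : set T, [/\ measurable A, mu A = 0%E & nu (~` A) = 0%E].

(* Main.v *)
Require Import Defs.
From HB Require Import structures.
From mathcomp Require Import all_boot all_order all_algebra.
From mathcomp Require Import all_classical all_reals all_analysis.
From mathcomp Require Import measurable_realfun.
From mathcomp Require Import ring lra zify.

(** Every move of the dual walk preserves uniformity given the depth, so the
    dual harmonic measure has vanishing nonzero Fourier coefficients (it is
    Lebesgue measure). In the primal graph everything below depth n is invariant
    under translation by 2^-n; hence each Fourier mode m of the electric current
    leaving level n is that of level n - 1 times a factor
    transfer (2 pi m / 2^n) in ]0, 1], and the m-th coefficient of the harmonic
    measure is
      c m = prod_(j >= 1) transfer (2 pi m / 2^j).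
    The function transfer is even, 2 pi-periodic, Lipschitz and equal to 1 at 0,
    so c (2 m) = c m, c 1 > 0 and c (2^d +- 1) tends to (c 1)^2. Thus averages
    of cos (2 pi 2^k x) over sparse k concentrate at c 1 > 0 for the harmonic
    measure and at 0 for its dual; Borel-Cantelli turns this into a separating
    set. *)

Set Implicit Arguments.
Unset Strict Implicit.
Unset Printing Implicit Defensive.

Import Order.TTheory GRing.Theory Num.Theory.
Import numFieldNormedType.Exports.

Local Open Scope classical_set_scope.
Local Open Scope ring_scope.

(** * Binary strings and their positions *)

(** The obstacle is that a mode is not closed under descent: only strings ending in 0 have an upward
    edge, so on level [n + 1] mode [m] meets its alias [m + 2 ^ n], and the potential of level [n]
    depends on two potentials below it. This recursion has no starting value at the root, so it is
    solved from infinitely deep: [response] is the limit over grounded truncations, and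
    [response_error] measures how far the true potentials are from following it. The ratio 3/4 of
    the Lyapunov functions meets three demands: the walk contracts it; its inverse 4/3, which bounds
    the growth of the potentials, stays below 3/2, the inverse of the contraction factor; and it
    exceeds 1/2, so that it dominates the symbols, which decay like 2^-n along the levels. It also
    makes every Green sum converge geometrically. *)

Lemma bval_rcons (w : bstring) b : bval (rcons w b) = (2 * bval w + b)%N.
Proof.
rewrite /bval size_rcons big_ord_recr /= nth_rcons ltnn eqxx subnn muln1.
congr addn; rewrite big_distrr /=; apply: eq_bigr => i _.
rewrite nth_rcons ltn_ord subSn ?ltn_ord// expnS; ring.
Qed.

Lemma bval_ltn (w : bstring) : (bval w < 2 ^ size w)%N.
Proof.
elim/last_ind: w => [|w b IHw]; first by rewrite /bval big_ord0.
by rewrite bval_rcons size_rcons expnS; case: b; lia.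
Qed.

Lemma bits_rcons n m : bits n.+1 m = rcons (bits n m./2) (odd m).
Proof.
rewrite /bits /mkseq -[X in iota _ X]addn1 iotaD add0n map_cat /=
  subnn expn0 divn1 cats1.
congr rcons; apply/eq_in_map => j; rewrite mem_iota add0n => /andP[_ jn].
by rewrite subSn// expnS divnMA divn2.
Qed.

Lemma bits_bit n k (b : bool) : bits n.+1 (2 * k + b) = rcons (bits n k) b.
Proof.
by rewrite bits_rcons addnC mul2n half_bit_double oddD odd_double addbF oddb.
Qed.

Lemma bits_bval (w : bstring) : bits (size w) (bval w) = w.
Proof.
elim/last_ind: w => [//|w b IHw].
by rewrite size_rcons bval_rcons bits_bit IHw.
Qed.

Lemma add1_nil : add1 [::] = [::]. Proof. by []. Qed.

Lemma sub1_nil : sub1 [::] = [::]. Proof. by []. Qed.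

(** The carry rules of the odometer: with them, horizontal moves are handled by induction on the
    last digit. *)
Lemma add1_rcons0 (w : bstring) : add1 (rcons w false) = rcons w true.
Proof.
rewrite /add1 bval_rcons size_rcons expnS addn0 modn_small; last first.
  by have := bval_ltn w; lia.
by rewrite (bits_bit _ _ true) bits_bval.
Qed.

Lemma add1_rcons1 (w : bstring) :
  add1 (rcons w true) = rcons (add1 w) false.
Proof.
rewrite /add1 bval_rcons size_rcons expnS /=.
rewrite (_ : 2 * bval w + 1 + 1 = 2 * (bval w + 1))%N; last by ring.
by rewrite -muln_modr -[X in bits _ X]addn0 (bits_bit _ _ false).
Qed.

Lemma sub1_rcons1 (w : bstring) : sub1 (rcons w true) = rcons w false.
Proof.
have wlt := bval_ltn w; rewrite /sub1 bval_rcons size_rcons expnS /=.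
rewrite (_ : 2 * bval w + 1 + 2 * 2 ^ size w - 1 =
  2 * bval w + 2 * 2 ^ size w)%N; last by lia.
rewrite modnDr modn_small; last by lia.
by rewrite -[X in bits _ X]addn0 (bits_bit _ _ false) bits_bval.
Qed.

Lemma sub1_rcons0 (w : bstring) :
  sub1 (rcons w false) = rcons (sub1 w) true.
Proof.
have pw : (0 < 2 ^ size w)%N by rewrite expn_gt0.
rewrite /sub1 bval_rcons size_rcons expnS /= addn0.
rewrite (_ : 2 * bval w + 2 * 2 ^ size w - 1 =
  1 + 2 * (bval w + 2 ^ size w - 1))%N; last by lia.
rewrite -modnDmr -muln_modr modn_small; last first.
  by have := ltn_pmod (bval w + 2 ^ size w - 1) pw; lia.
by rewrite addnC (bits_bit _ _ true).
Qed.

Lemma size_add1 (w : bstring) : size (add1 w) = size w.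
Proof. by rewrite /add1 size_mkseq. Qed.

Lemma size_sub1 (w : bstring) : size (sub1 w) = size w.
Proof. by rewrite /sub1 size_mkseq. Qed.

Lemma remove_last_rcons (w : bstring) b : remove_last (rcons w b) = w.
Proof. by rewrite /remove_last size_rcons /= -cats1 take_size_cat. Qed.

Section Position.
Variable R : realType.
Implicit Types (w : bstring) (n m : nat).
Local Notation pos := (position R).

Lemma position_rcons w b : pos (rcons w b) = pos w + b%:R * 2^-1 ^+ (size w).+1.
Proof.
rewrite /position size_rcons big_ord_recr /= nth_rcons ltnn eqxx.
by congr (_ + _); apply: eq_bigr => i _; rewrite nth_rcons ltn_ord.
Qed.

Lemma position_nil : pos [::] = 0.
Proof. by rewrite /position big_ord0. Qed.

Lemma position_expn w : 2 ^+ size w * pos w = (bval w)%:R.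
Proof.
elim/last_ind: w => [|w b IHw]; first by rewrite position_nil mulr0
  /bval big_ord0.
rewrite size_rcons position_rcons bval_rcons natrD natrM -IHw exprS mulrDr.
rewrite mulrA; congr (_ + _); rewrite mulrCA -exprS -exprMn divff//.
by rewrite expr1n mulr1.
Qed.

(** The phase by which one horizontal step at depth [n] rotates mode [m]. *)
Definition level_angle m n : R := 2 * pi * m%:R / 2 ^+ n.
Definition string_cos m w : R := cos (2 * pi * m%:R * pos w).
(* Fourier multiplier of the horizontal part of minus the Laplacian. *)
Definition symbol (t : R) : R := 2 - 2 * cos t.

Lemma cosDn2pi (x : R) n : cos (x + 2 * pi * n%:R) = cos x.
Proof.
have -> : 2 * pi * n%:R = (pi *+ 2 : R) *+ n.
  by rewrite -[in RHS]mulr_natr -[(pi *+ 2 : R)]mulr_natl.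
exact/periodicn/cosD2pi.
Qed.

(** The number [k] counts the wrap around the circle; the cosines do not see it. *)
Lemma position_add1 w :
  exists k : nat, pos (add1 w) + k%:R = pos w + 2^-1 ^+ size w.
Proof.
elim/last_ind: w => [|w b [k kE]].
  by exists 1%N; rewrite add1_nil position_nil expr0.
case: b; rewrite size_rcons.
  exists k; rewrite add1_rcons1 !position_rcons size_add1 mul0r addr0 kE.
  rewrite /= !exprS; move: (2^-1 ^+ _) => z; lra.
by exists 0%N; rewrite add1_rcons0 !position_rcons mul1r mul0r !addr0.
Qed.

Lemma position_sub1 w :
  exists k : nat, pos (sub1 w) + 2^-1 ^+ size w = pos w + k%:R.
Proof.
elim/last_ind: w => [|w b [k kE]].
  by exists 1%N; rewrite sub1_nil position_nil expr0.
case: b; rewrite size_rcons.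
  by exists 0%N; rewrite sub1_rcons1 !position_rcons mul1r mul0r !addr0.
exists k; rewrite sub1_rcons0 !position_rcons size_sub1 mul0r addr0 -kE.
rewrite /= !exprS; move: (2^-1 ^+ _) => z; lra.
Qed.

Lemma level_angleE m n : level_angle m n = 2 * pi * m%:R * 2^-1 ^+ n.
Proof. by rewrite /level_angle exprVn. Qed.

(** The two neighbours differ in phase by plus and minus [level_angle], so the sine terms of the
    addition formulas cancel. *)
Lemma string_cos_add1_sub1 m w :
  string_cos m (add1 w) + string_cos m (sub1 w) =
    2 * cos (level_angle m (size w)) * string_cos m w.
Proof.
have [k kE] := position_add1 w; have [l lE] := position_sub1 w.
have -> : string_cos m (add1 w) = cos (2 * pi * m%:R * pos w +
  level_angle m (size w)).
  rewrite level_angleE -mulrDr -kE /string_cos -(cosDn2pi _ (m * k)); congr cos.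
  by rewrite natrM; ring.
have -> : string_cos m (sub1 w) = cos (2 * pi * m%:R * pos w -
  level_angle m (size w)).
  rewrite level_angleE -mulrBr (_ : pos w - _ = pos (sub1 w) - l%:R); last
    by lra.
  by rewrite -[RHS](cosDn2pi _ (m * l)) /string_cos; congr cos; rewrite natrM;
    ring.
by rewrite cosD cosB /string_cos; ring.
Qed.

Lemma string_cos_rcons0 m w : string_cos m (rcons w false) = string_cos m w.
Proof. by rewrite /string_cos position_rcons mul0r addr0. Qed.

(** Aliasing: positions at depth at most [n] are multiples of 2^-n, on which frequency [2 ^ n] makes
    whole turns. *)
Lemma string_cos_shift m w n : (size w <= n)%N ->
  string_cos (m + 2 ^ n) w = string_cos m w.
Proof.
move=> wn; rewrite /string_cos -[RHS](cosDn2pi _ (2 ^ (n - size w) * bval w)).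
congr cos; rewrite !natrM -position_expn natrD -{1}(subnK wn) expnD
  !natrX natrM.
by rewrite !natrX; ring.
Qed.

(** Frequency [2 ^ size w] makes whole turns on the prefix [w] and half a turn on a final digit
    1. *)
Lemma string_cos_half m w b :
  string_cos (m + 2 ^ size w) (rcons w b) =
    (-1) ^+ b * string_cos m (rcons w b).
Proof.
rewrite /string_cos position_rcons.
rewrite -[in RHS](cosDn2pi _ (bval w)) -position_expn natrD natrX.
case: b; rewrite /= ?mul0r ?addr0 ?mul1r ?expr0 ?expr1 ?mulN1r ?mul1r.
  rewrite -cosDpi; congr cos; rewrite exprVn exprS.
  have : (2 : R) ^+ size w != 0 by rewrite expf_neq0.
  by move: (_ ^+ size w) => a a0; field.
by congr cos; ring.
Qed.

Lemma string_cos_norm_le1 m w : `|string_cos m w| <= 1.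
Proof. exact: cos_max. Qed.

Lemma string_cos_nil m : string_cos m [::] = 1.
Proof. by rewrite /string_cos position_nil mulr0 cos0. Qed.

Lemma level_angle_shift m n j : (j <= n)%N ->
  level_angle (m + 2 ^ n) j = level_angle m j + 2 * pi * (2 ^ (n - j))%:R.
Proof.
move=> jn; rewrite /level_angle natrD -{1}(subnK jn) expnD natrM !natrX.
by field; rewrite expf_neq0.
Qed.

Lemma symbol_level_angle_shift m n j : (j <= n)%N ->
  symbol (level_angle (m + 2 ^ n) j) = symbol (level_angle m j).
Proof. by move=> jn; rewrite /symbol level_angle_shift// cosDn2pi. Qed.

Lemma symbol_ge0 t : 0 <= symbol t.
Proof. by rewrite /symbol; have := cos_le1 t; lra. Qed.

Lemma symbol_le4 t : symbol t <= 4.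
Proof. by rewrite /symbol; have := cos_geN1 t; lra. Qed.

Lemma symbolDpi t : symbol (t + pi) = 4 - symbol t.
Proof. by rewrite /symbol cosDpi; ring. Qed.

Lemma symbolN t : symbol (- t) = symbol t.
Proof. by rewrite /symbol cosN. Qed.

Lemma symbolDn2pi t n : symbol (t + 2 * pi * n%:R) = symbol t.
Proof. by rewrite /symbol cosDn2pi. Qed.

Lemma symbol0 : symbol 0 = 0.
Proof. by rewrite /symbol cos0 mulr1 subrr. Qed.

Lemma cos_lipschitz (x y : R) : `|cos x - cos y| <= `|x - y|.
Proof.
wlog xy : x y / x <= y.
  move=> H; have [|/ltW] := leP x y; first exact: H.
  by move=> /H; rewrite distrC [`|y - x|]distrC.
have [|c _ E] := @MVT_segment R cos (fun x => - sin x) x y xy.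
  by apply: continuous_subspaceT; exact: continuous_cos.
rewrite distrC E normrM normrN [`|x - y|]distrC ler_piMl//.
exact: sin_max.
Qed.

Lemma symbol_lipschitz (x y : R) : `|symbol x - symbol y| <= 2 * `|x - y|.
Proof.
rewrite (_ : symbol x - symbol y = 2 * (cos y - cos x)); last
  by rewrite /symbol; ring.
by rewrite normrM ger0_norm// ler_pM2l// [`|x - y|]distrC cos_lipschitz.
Qed.

End Position.

(** * The response of the levels below *)

Section Feedback.
Variable R : realType.
Implicit Types (t x y l b : R) (n k : nat).
Local Notation symbol := (@symbol R).

(* In the mode with symbol l, a level with response b damps the incoming current
   by the factor 1 / (1 + l * b), and damp l b is its resulting potential. *)
Definition damp l b : R := b / (1 + l * b).

Lemma damp_den l b : 0 <= l -> 0 <= b -> 0 < 1 + l * b.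
Proof. by move=> l0 b0; rewrite ltr_wpDr ?mulr_ge0. Qed.

Lemma damp_ge0 l b : 0 <= l -> 0 <= b -> 0 <= damp l b.
Proof. by move=> l0 b0; rewrite divr_ge0// ltW// damp_den. Qed.

Lemma damp_le_id l b : 0 <= l -> 0 <= b -> damp l b <= b.
Proof.
move=> l0 b0; rewrite /damp ler_pdivrMr ?damp_den//.
by rewrite mulrDr mulr1 lerDl !mulr_ge0.
Qed.

Lemma damp_le_half l b : 2 <= l -> 0 <= b -> damp l b <= 2^-1.
Proof.
move=> l2 b0; have l0 : 0 <= l by rewrite (le_trans _ l2).
by rewrite /damp ler_pdivrMr ?damp_den//; have := ler_wpM2r b0 l2; lra.
Qed.

Lemma damp_diff l b l' b' : 0 <= l -> 0 <= b -> 0 <= l' -> 0 <= b' ->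
  damp l b - damp l' b' =
  (b - b' + b * b' * (l' - l)) / ((1 + l * b) * (1 + l' * b')).
Proof.
move=> l0 b0 l'0 b'0; rewrite /damp.
by field; rewrite !gt_eqF ?damp_den.
Qed.

Lemma damp_le l b b' : 0 <= l -> 0 <= b -> b <= b' -> damp l b <= damp l b'.
Proof.
move=> l0 b0 bb'; have b'0 := le_trans b0 bb'.
rewrite -subr_ge0 damp_diff// subrr mulr0 addr0.
by rewrite divr_ge0 ?subr_ge0// mulr_ge0// ltW// damp_den.
Qed.

Lemma damp_lipschitz l b l' b' : 0 <= l -> 0 <= b -> 0 <= l' -> 0 <= b' ->
  `|damp l b - damp l' b'| <= `|b - b'| + b * b' * `|l - l'|.
Proof.
move=> l0 b0 l'0 b'0; rewrite damp_diff// normrM normfV.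
have d0 : 0 < (1 + l * b) * (1 + l' * b') by rewrite mulr_gt0 ?damp_den.
rewrite [X in _ / X](gtr0_norm d0) ler_pdivrMr//.
have le1 : 1 <= (1 + l * b) * (1 + l' * b').
  by rewrite mulr_ege1// lerDl mulr_ge0.
apply: (@le_trans _ _ (`|b - b'| + b * b' * `|l - l'|)).
  rewrite (le_trans (ler_normD _ _))// lerD2l normrM ger0_norm ?mulr_ge0//.
  by rewrite [`|l' - l|]distrC.
by rewrite ler_peMr// addr_ge0// !mulr_ge0.
Qed.

(* The ratio of potential to outgoing current of the mode of angle t on one
   level is 1, for the edge downwards, plus the mean potential of the modes
   t / 2 and t / 2 + pi of the next level: these two agree on even strings. *)
Definition feedback (f : R -> R) t : R :=
  1 + (damp (symbol (t / 2)) (f (t / 2)) +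
    damp (symbol (t / 2 + pi)) (f (t / 2 + pi))) / 2.

(** The [k]-th iterate is the response of a level when the level [k + 1] steps below it is grounded;
    the initial 1 is a single edge downwards. *)
Fixpoint response_iter k : R -> R :=
  if k is k'.+1 then feedback (response_iter k') else fun=> 1.

(** Symbols at angles differing by [pi] add up to 4, so one of them is at least 2 and its damped
    response is at most 1/2. The bound 5/2 solves b = 1 + (1/2 + b)/2. *)
Lemma response_iter_bound k t : 1 <= response_iter k t <= 5 / 2.
Proof.
elim: k t => [|k IHk] t; first by rewrite /=; lra.
rewrite /= /feedback.
have /andP[b1 b2] := IHk (t / 2); have /andP[c1 c2] := IHk (t / 2 + pi).
have b0 : 0 <= response_iter k (t / 2) by lra.
have c0 : 0 <= response_iter k (t / 2 + pi) by lra.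
have lb := symbol_ge0 (t / 2); have lc := symbol_ge0 (t / 2 + pi).
have := damp_ge0 lb b0; have := damp_ge0 lc c0.
have := damp_le_id lb b0; have := damp_le_id lc c0.
have [l2|l2] := leP 2 (symbol (t / 2)).
  by have := damp_le_half l2 b0; lra.
have l2' : 2 <= symbol (t / 2 + pi) by rewrite symbolDpi; lra.
by have := damp_le_half l2' c0; lra.
Qed.

Lemma response_iter_ge0 k t : 0 <= response_iter k t.
Proof. by have := response_iter_bound k t; lra. Qed.

Lemma response_iter_le k t : response_iter k t <= response_iter k.+1 t.
Proof.
elim: k t => [|k IHk] t; first by have /andP[] := response_iter_bound 1 t.
rewrite [X in X <= _]/= [X in _ <= X]/= {1}/feedback [X in _ <= X]/feedback.
rewrite lerD2l ler_pM2r// lerD// damp_le//;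
  do ?[exact: symbol_ge0|exact: response_iter_ge0].
Qed.

Lemma symbol2pi t : symbol (t + 2 * pi) = symbol t.
Proof. by have := symbolDn2pi t 1; rewrite mulr1. Qed.

Lemma response_iter_periodic k t : response_iter k (t + 2 * pi) =
  response_iter k t.
Proof.
elim: k t => [//|k IHk] t; rewrite /= /feedback.
have -> : (t + 2 * pi) / 2 = t / 2 + pi by field.
have -> : t / 2 + pi + pi = t / 2 + 2 * pi by ring.
by rewrite IHk symbol2pi [X in X / 2]addrC.
Qed.

Lemma response_iter_even k t : response_iter k (- t) = response_iter k t.
Proof.
elim: k t => [//|k IHk] t; rewrite /= /feedback mulNr.
have -> : - (t / 2) + pi = - (t / 2 - pi) by ring.
rewrite !symbolN !IHk.
have -> : t / 2 + pi = t / 2 - pi + 2 * pi by ring.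
by rewrite symbol2pi response_iter_periodic.
Qed.

(** Halving the angle halves the constant: [L] becomes (L + 2 * 25/4)/2, where 25/4 bounds the
    product of two responses and 2 is the Lipschitz constant of [symbol]. The fixed point is
    25/2. *)
Lemma response_iter_lipschitz k x y :
  `|response_iter k x - response_iter k y| <= 25 / 2 * `|x - y|.
Proof.
elim: k x y => [|k IHk] x y; first by rewrite subrr normr0 mulr_ge0.
have H a c : `|damp (symbol a) (response_iter k a) -
  damp (symbol c) (response_iter k c)| <= 25 * `|a - c|.
  apply: le_trans (damp_lipschitz _ _ _ _) _; do ?exact: symbol_ge0; do ?exact:
    response_iter_ge0.
  have bc : response_iter k a * response_iter k c <= 25 / 4.
    apply: (@le_trans _ _ (5 / 2 * (5 / 2))); last by lra.
    by apply: ler_pM; rewrite ?response_iter_ge0//;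
      [have := response_iter_bound k a|have := response_iter_bound k c]; lra.
  have := symbol_lipschitz a c; have := IHk a c => h1 h2.
  have : response_iter k a * response_iter k c * `|symbol a - symbol c| <=
    25 / 4 * (2 * `|a - c|).
    by apply: ler_pM => //; rewrite mulr_ge0// response_iter_ge0.
  by lra.
rewrite /= /feedback.
set p1 := damp _ _; set p2 := damp _ _; set q1 := damp _ _; set q2 := damp _ _.
have -> : 1 + (p1 + p2) / 2 - (1 + (q1 + q2) / 2) =
  (p1 - q1) / 2 + (p2 - q2) / 2.
  by field.
apply: le_trans (ler_normD _ _) _.
rewrite !normrM (@ger0_norm _ 2^-1)//.
have e1 := H (x / 2) (y / 2); have e2 := H (x / 2 + pi) (y / 2 + pi).
have d1 : `|x / 2 - y / 2| = `|x - y| / 2.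
  by rewrite -mulrBl normrM (@ger0_norm _ 2^-1).
have d2 : `|x / 2 + pi - (y / 2 + pi)| = `|x - y| / 2.
  by rewrite -d1; congr `|_|; ring.
by rewrite d1 in e1; rewrite d2 in e2; rewrite -/p1 -/q1 in e1;
  rewrite -/p2 -/q2 in e2; lra.
Qed.

Definition response t : R := limn (response_iter ^~ t).

Lemma cvg_response_iter t : response_iter ^~ t @ \oo --> response t.
Proof.
apply: nondecreasing_is_cvgn.
  by apply/nondecreasing_seqP => n; exact: response_iter_le.
by exists (5 / 2) => _ [n _ <-]; have /andP[] := response_iter_bound n t.
Qed.

Lemma response_bound t : 1 <= response t <= 5 / 2.
Proof.
have c := cvgP _ (@cvg_response_iter t).
apply/andP; split.
  by apply: limr_ge => //; near=> n; have /andP[] := response_iter_bound n t.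
by apply: limr_le => //; near=> n; have /andP[] := response_iter_bound n t.
Unshelve. all: by end_near. Qed.

Lemma response_ge0 t : 0 <= response t.
Proof. by have := response_bound t; lra. Qed.

Lemma responseDn2pi t n : response (t + 2 * pi * n%:R) = response t.
Proof.
elim: n => [|n IHn]; first by rewrite mulr0 addr0.
rewrite -IHn -[n.+1]addn1 natrD mulrDr mulr1 addrA /response; congr (limn _).
by apply/funext => k; exact: response_iter_periodic.
Qed.

Lemma responseN t : response (- t) = response t.
Proof.
by rewrite /response; congr (limn _); apply/funext => k; exact:
  response_iter_even.
Qed.

Lemma response_lipschitz x y : `|response x - response y| <= 25 / 2 * `|x - y|.
Proof.
have c : (fun k => `|response_iter k x - response_iter k y|) @ \oo -->
  `|response x - response y|.
  by apply: cvg_norm; apply: cvgB; exact: cvg_response_iter.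
rewrite -(cvg_lim _ c)//; apply: limr_le; first exact: cvgP c.
by near=> n; exact: response_iter_lipschitz.
Unshelve. all: by end_near. Qed.

Lemma response_feedback t : response t = feedback response t.
Proof.
have c : (fun k => response_iter k.+1 t) @ \oo --> feedback response t.
  have cdamp z : (fun k => damp (symbol z) (response_iter k z)) @ \oo -->
    damp (symbol z) (response z).
    apply: cvgM; first exact: cvg_response_iter.
    apply: cvgV; first by rewrite gt_eqF// damp_den ?symbol_ge0 ?response_ge0.
    by apply: cvgD; [exact: cvg_cst|apply: cvgM;
      [exact: cvg_cst|exact: cvg_response_iter]].
  apply: cvgD; first exact: cvg_cst.
  by apply: cvgM; [apply: cvgD; exact: cdamp|exact: cvg_cst].
have c' : (fun k => response_iter k.+1 t) @ \oo --> response t.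
  by rewrite (cvg_shiftS (response_iter ^~ t)); exact: cvg_response_iter.
by rewrite -(cvg_lim _ c)// -(cvg_lim _ c').
Qed.

(** The horizontal edges of the next level drain [symbol t] times its potential V, so the current I
    there becomes I' = I - [symbol t] V. If V = [response t] I', then I' = [transfer t] I. *)
Definition transfer t : R := (1 + symbol t * response t)^-1.

Lemma transfer_den t : 0 < 1 + symbol t * response t.
Proof. by rewrite damp_den ?symbol_ge0 ?response_ge0. Qed.

Lemma transfer_gt0 t : 0 < transfer t.
Proof. by rewrite invr_gt0 transfer_den. Qed.

Lemma transfer_le1 t : transfer t <= 1.
Proof.
by rewrite invf_le1 ?transfer_den// lerDl mulr_ge0 ?symbol_ge0 ?response_ge0.
Qed.

(** Both denominators are at least 1, so only the variation of [symbol] times [response] counts: 4 *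
    25/2 + 5/2 * 2 = 55. *)
Lemma transfer_lipschitz x y : `|transfer x - transfer y| <= 55 * `|x - y|.
Proof.
have dx := transfer_den x; have dy := transfer_den y.
have -> : transfer x - transfer y =
    (symbol y * (response y - response x) + response x * (symbol y - symbol x))
      * (transfer x * transfer y).
  by rewrite /transfer; field; rewrite !gt_eqF.
have h1 := response_lipschitz y x; have h2 := symbol_lipschitz y x.
rewrite [`|y - x|]distrC in h1 h2.
have pp : 0 < transfer x * transfer y by rewrite mulr_gt0 ?transfer_gt0.
rewrite normrM [X in _ * X](gtr0_norm pp).
apply: (@le_trans _ _ (`|symbol y * (response y - response x) + response x *
  (symbol y - symbol x)|)).
  by rewrite ler_piMr// mulr_ile1 ?transfer_le1// ltW// transfer_gt0.
apply: le_trans (ler_normD _ _) _.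
rewrite !normrM (ger0_norm (symbol_ge0 _)) (ger0_norm (response_ge0 _)).
have k1 : symbol y * `|response y - response x| <= 4 * (25 / 2 * `|x - y|).
  by apply: ler_pM; rewrite ?symbol_ge0 ?symbol_le4.
have k2 : response x * `|symbol y - symbol x| <= 5 / 2 * (2 * `|x - y|).
  by apply: ler_pM; rewrite ?response_ge0//; have /andP[] := response_bound x.
by lra.
Qed.

Lemma transferDn2pi t n : transfer (t + 2 * pi * n%:R) = transfer t.
Proof. by rewrite /transfer symbolDn2pi responseDn2pi. Qed.

Lemma transferN t : transfer (- t) = transfer t.
Proof. by rewrite /transfer symbolN responseN. Qed.

Lemma transfer2pin n : transfer (2 * pi * n%:R) = 1.
Proof.
by rewrite -[2 * pi * _]add0r transferDn2pi /transfer symbol0 mul0r addr0 invr1.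
Qed.

Definition transfer_prod n t : R := \prod_(j < n)
  transfer (2 * pi * t / 2 ^+ j.+1).

Lemma transfer_prod_recr n t : transfer_prod n.+1 t =
  transfer_prod n t * transfer (2 * pi * t / 2 ^+ n.+1).
Proof. by rewrite /transfer_prod big_ord_recr. Qed.

Lemma transfer_prod_gt0 n t : 0 < transfer_prod n t.
Proof. by apply: prodr_gt0 => i _; exact: transfer_gt0. Qed.

Lemma transfer_prod_le1 n t : transfer_prod n t <= 1.
Proof.
by apply: prodr_ile1 => i _; rewrite transfer_le1 ltW// transfer_gt0.
Qed.

Lemma transfer_prod0 n : transfer_prod n 0 = 1.
Proof.
by apply: big1 => i _; rewrite mulr0 mul0r -(mulr0 (2 * pi)) (transfer2pin 0).
Qed.

Lemma transfer_prod_lipschitz n x y :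
  `|transfer_prod n x - transfer_prod n y| <= 110 * pi * `|x - y|.
Proof.
(* Strengthened for the induction: the factor of index [j] contributes 55 * 2 pi 2^-(j+1), and
   [1 - 2^-1 ^+ n] is the partial sum of these powers. *)
apply: (@le_trans _ _ (110 * pi * `|x - y| * (1 - 2^-1 ^+ n))); last first.
  by rewrite ler_piMr// !mulr_ge0// pi_ge0.
elim: n => [|n IHn].
  by rewrite /transfer_prod !big_ord0 !subrr normr0 mulr0.
rewrite !transfer_prod_recr; set a := transfer_prod n x; set c :=
  transfer_prod n y; set p := transfer _; set q := transfer _.
have -> : a * p - c * q = (a - c) * p + c * (p - q) by ring.
apply: le_trans (ler_normD _ _) _; rewrite !normrM.
have pq : `|p - q| <= 55 * (2 * pi * `|x - y| * 2^-1 ^+ n.+1).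
  apply: le_trans (transfer_lipschitz _ _) _; rewrite ler_pM2l//.
  rewrite -mulrBl -mulrBr !normrM normfV (ger0_norm (pi_ge0 _)) normrX.
  by rewrite exprVn (@ger0_norm _ 2).
have h1 : `|a - c| * `|p| <= `|a - c|.
  by rewrite ler_piMr// ger0_norm ?transfer_le1// ltW// transfer_gt0.
have h2 : `|c| * `|p - q| <= `|p - q|.
  by rewrite ler_piMl// ger0_norm ?transfer_prod_le1// ltW// transfer_prod_gt0.
apply: le_trans (lerD h1 h2) _; apply: le_trans (lerD IHn pq) _.
by rewrite exprS; set z := _ ^+ n; rewrite le_eqVlt; apply/orP; left; apply/eqP;
  field.
Qed.

Lemma transfer_prodD d n t : transfer_prod (d + n) t =
  transfer_prod d t * transfer_prod n (t / 2 ^+ d).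
Proof.
rewrite /transfer_prod big_split_ord /=; congr (_ * _); apply: eq_bigr => i _.
by rewrite -addnS exprD; congr transfer; field; rewrite !expf_neq0.
Qed.

(** The first factor has a whole number of turns as its angle and equals 1; the others are shifted
    by one place. *)
Lemma transfer_prod_double n m : transfer_prod n.+1 (2 * m)%:R =
  transfer_prod n m%:R.
Proof.
rewrite /transfer_prod big_ord_recl /= expr1 natrM.
have -> : 2 * pi * (2 * m%:R) / 2 = 2 * pi * m%:R :> R by field.
rewrite transfer2pin mul1r; apply: eq_bigr => i _; rewrite /bump add1n.
by congr transfer; rewrite [in LHS]exprS; field; rewrite !expf_neq0.
Qed.

(** The first [d] factors see [2 ^+ d] as whole turns and, [transfer] being even, do not see the
    sign of [e]. The other factors are those of the rescaled argument, which is close to 1. This is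
    the source of the product of two coefficients in the limit. *)
Lemma transfer_prod_shift d n (e : R) : e = 1 \/ e = -1 ->
  transfer_prod (d + n) (2 ^+ d + e) =
    transfer_prod d 1 * transfer_prod n (1 + e / 2 ^+ d).
Proof.
move=> e1; rewrite transfer_prodD; congr (_ * transfer_prod n _); last first.
  by field; rewrite !expf_neq0.
apply: eq_bigr => i _.
have -> : 2 * pi * (2 ^+ d + e) / 2 ^+ i.+1 =
    2 * pi * e / 2 ^+ i.+1 + 2 * pi * (2 ^ (d - i.+1))%:R.
  have -> : (2 : R) ^+ d = 2 ^+ (d - i.+1) * 2 ^+ i.+1.
    by rewrite -exprD subnK// ltn_ord.
  rewrite natrX.
  by field; rewrite !expf_neq0.
rewrite transferDn2pi; case: e1 => ->//.
by rewrite mulrN mulNr transferN.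
Qed.

End Feedback.

(** * Green operators under a Lyapunov function *)

Section Walk.
Variables (R : realType) (G : multigraph).
Hypothesis G_gt0 : forall w, (0 < size (G w))%N.
Implicit Types (g u : bstring -> R) (w : bstring) (k n : nat).

Definition avg g w : R := (\sum_(v <- G w) g v) / (size (G w))%:R.
Definition walk_mean k g : R := iter k avg g [::].
(** Not normalised: the degree depends on the last digit, and dividing by it here would mix the
    Fourier modes. The division is placed in [green]. *)
Definition laplacian g w : R := \sum_(v <- G w) (g v - g w).

Lemma deg_gt0 w : 0 < (size (G w))%:R :> R.
Proof. by rewrite ltr0n. Qed.

Lemma walk_meanS k g : walk_mean k.+1 g = walk_mean k (avg g).
Proof. by rewrite /walk_mean iterSr. Qed.

Lemma iter_avgD k g u w :
  iter k avg (fun v => g v + u v) w = iter k avg g w + iter k avg u w.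
Proof.
elim: k w => [//|k IHk] w; rewrite !iterS /avg -mulrDl -big_split/=.
by congr (_ / _); apply: eq_bigr => v _; exact: IHk.
Qed.

Lemma iter_avgZ k (c : R) g w :
  iter k avg (fun v => c * g v) w = c * iter k avg g w.
Proof.
elim: k w => [//|k IHk] w; rewrite !iterS /avg mulrA mulr_sumr.
by congr (_ / _); apply: eq_bigr => v _; exact: IHk.
Qed.

Lemma iter_avg_le k g u w : (forall v, g v <= u v) ->
  iter k avg g w <= iter k avg u w.
Proof.
move=> gu; elim: k w => [|k IHk] w; first exact: gu.
by rewrite !iterS /avg ler_pM2r ?invr_gt0 ?deg_gt0//; apply: ler_sum => v _;
  exact: IHk.
Qed.

Lemma walk_meanD k g u : walk_mean k (fun v => g v + u v) =
  walk_mean k g + walk_mean k u.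
Proof. exact: iter_avgD. Qed.

Lemma walk_meanZ k c g : walk_mean k (fun v => c * g v) = c * walk_mean k g.
Proof. exact: iter_avgZ. Qed.

Lemma walk_mean_le k g u : (forall v, g v <= u v) ->
  walk_mean k g <= walk_mean k u.
Proof. exact: iter_avg_le. Qed.

Lemma walk_mean_norm k g u : (forall v, `|g v| <= u v) ->
  `|walk_mean k g| <= walk_mean k u.
Proof.
move=> gu; rewrite ler_norml -mulN1r -walk_meanZ !walk_mean_le// => v.
  by have := gu v; rewrite ler_norml => /andP[].
by rewrite mulN1r; have := gu v; rewrite ler_norml => /andP[].
Qed.

Lemma avg_laplacian g w : avg g w = g w + laplacian g w / (size (G w))%:R.
Proof.
rewrite /avg /laplacian sumrB big_const_seq count_predT iter_addr_0 -mulr_natr.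
by field; rewrite gt_eqF ?deg_gt0.
Qed.

Lemma walk_mean_telescope n g : walk_mean n g =
  g [::] + series (fun k => walk_mean k (fun w =>
    laplacian g w / (size (G w))%:R)) n.
Proof.
elim: n => [|n IHn]; first by rewrite /series/= big_geq// addr0.
rewrite seriesS addrCA -IHn walk_meanS addrC -walk_meanD.
by congr (walk_mean n _); apply/funext => w; exact: avg_laplacian.
Qed.

(* The sum of g w * V w over all w, where V w is the expected number of visits
   to w divided by the degree of w; in these terms V solves
   sum over the edges at w of (V w - V w') = 1 at the start and 0 elsewhere. *)
Definition green g : R :=
  limn (series (fun k => walk_mean k (fun w => g w / (size (G w))%:R))).

Variables (h : bstring -> R) (rho : R).
Hypotheses (rho_ge0 : 0 <= rho) (rho_lt1 : rho < 1).
Hypothesis h_ge0 : forall w, 0 <= h w.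
Hypothesis h_super : forall w, avg h w <= rho * h w.

Lemma walk_mean_lyapunov k : walk_mean k h <= rho ^+ k * h [::].
Proof.
elim: k => [|k IHk]; first by rewrite expr0 mul1r.
rewrite walk_meanS (le_trans (walk_mean_le k h_super))// walk_meanZ exprS
  -mulrA.
by rewrite ler_wpM2l.
Qed.

Definition dominated g (c : R) := forall w, `|g w| <= c * h w.

Lemma walk_mean_dominated k g c : 0 <= c -> dominated g c ->
  `|walk_mean k g| <= geometric (c * h [::]) rho k.
Proof.
move=> c0 gc; rewrite (le_trans (walk_mean_norm k gc))// walk_meanZ /geometric
  /= -mulrA.
by rewrite ler_wpM2l// mulrC walk_mean_lyapunov.
Qed.

Lemma walk_mean_dominated_cvg0 g c : 0 <= c -> dominated g c ->
  walk_mean ^~ g @ \oo --> 0.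
Proof.
move=> c0 gc; apply/norm_cvg0P.
apply: (@squeeze_cvgr _ _ _ _ (cst 0) (geometric (c * h [::]) rho)).
- by near=> k; rewrite /cst normr_ge0 walk_mean_dominated.
- exact: cvg_cst.
- by apply: cvg_geometric; rewrite ger0_norm.
Unshelve. all: by end_near. Qed.

Lemma dominated_deg g c : 0 <= c -> dominated g c ->
  dominated (fun w => g w / (size (G w))%:R) c.
Proof.
move=> c0 gc w; rewrite normrM normfV normr_nat (le_trans _ (gc w))//.
by rewrite ler_pdivrMr ?deg_gt0// ler_peMr// ler1n.
Qed.

Lemma green_is_cvg g c : 0 <= c -> dominated g c ->
  cvgn (series (fun k => walk_mean k (fun w => g w / (size (G w))%:R))).
Proof.
move=> c0 /(dominated_deg c0) gc; apply: normed_cvg.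
apply: (@series_le_cvg _ _ (geometric (c * h [::]) rho)) => [n|n|n|].
- exact: normr_ge0.
- by rewrite /geometric /= !mulr_ge0// exprn_ge0.
- exact: walk_mean_dominated.
- by apply: is_cvg_geometric_series; rewrite ger0_norm.
Qed.

Lemma green_norm g c : 0 <= c -> dominated g c ->
  `|green g| <= c * h [::] / (1 - rho).
Proof.
move=> c0 gc; have gc' := dominated_deg c0 gc.
have rho1 : `|rho| < 1 by rewrite ger0_norm.
have cg := is_cvg_geometric_series (a := c * h [::]) rho1.
have cn : cvgn [normed series (fun k =>
  walk_mean k (fun w => g w / (size (G w))%:R))].
  apply: (@series_le_cvg _ _ (geometric (c * h [::]) rho)) => [n|n|n|//].
  - exact: normr_ge0.
  - by rewrite /geometric /= !mulr_ge0// exprn_ge0.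
  - exact: walk_mean_dominated.
rewrite (le_trans (lim_series_norm cn))//.
rewrite -(cvg_lim _ (cvg_geometric_series (a := c * h [::]) rho1))//.
by apply: lim_series_le => // n; exact: walk_mean_dominated.
Qed.

Lemma greenD g u c d : 0 <= c -> dominated g c -> 0 <= d -> dominated u d ->
  green (fun w => g w + u w) = green g + green u.
Proof.
move=> c0 gc d0 ud; rewrite /green.
have -> : (fun k => walk_mean k (fun w => (g w + u w) / (size (G w))%:R)) =
    (fun k => walk_mean k (fun w => g w / (size (G w))%:R)) +
    (fun k => walk_mean k (fun w => u w / (size (G w))%:R)).
  apply/funext => k; rewrite [RHS]/= -[RHS]walk_meanD; congr walk_mean.
  by apply/funext => w; rewrite mulrDl.
by rewrite seriesD; apply: limD; [exact: green_is_cvg gc|exact: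
  green_is_cvg ud].
Qed.

Lemma greenZ g (a : R) c : 0 <= c -> dominated g c ->
  green (fun w => a * g w) = a * green g.
Proof.
move=> c0 gc; rewrite /green.
have -> : (fun k => walk_mean k (fun w => (a * g w) / (size (G w))%:R)) =
    a *: (fun k => walk_mean k (fun w => g w / (size (G w))%:R)).
  apply/funext => k; rewrite [RHS]/= -[RHS]walk_meanZ; congr walk_mean.
  by apply/funext => w; rewrite mulrA.
by rewrite seriesZ; apply: cvg_lim => //; apply: cvgZl_tmp; exact:
  green_is_cvg gc.
Qed.

Lemma dominated_laplacian_cvg g c : 0 <= c -> dominated (laplacian g) c ->
  walk_mean ^~ g @ \oo --> g [::] + green (laplacian g).
Proof.
move=> c0 gc; have -> : walk_mean ^~ g = (fun n => g [::] +
    series (fun k => walk_mean k (fun w => laplacian g w / (size (G w))%:R)) n).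
  by apply/funext => n; exact: walk_mean_telescope.
by apply: cvgD; [exact: cvg_cst|exact: green_is_cvg gc].
Qed.

(** The telescoped sum of the increments of [walk_mean] runs from the value at the root to 0, since
    the walk leaves every dominated function behind. *)
Lemma green_laplacian g c d : 0 <= c -> dominated (laplacian g) c ->
  0 <= d -> dominated g d -> green (laplacian g) = - g [::].
Proof.
move=> c0 lc d0 gd.
have := cvg_lim (@norm_hausdorff _ _) (dominated_laplacian_cvg c0 lc).
rewrite (cvg_lim (@norm_hausdorff _ _) (walk_mean_dominated_cvg0 d0 gd)).
by move=> E; apply/eqP; rewrite -addr_eq0 addrC -E.
Qed.

End Walk.

(** * Fourier coefficients of the primal walk *)

Section GammaWalk.
Variable R : realType.
Implicit Types (w : bstring) (m n k : nat) (a : nat -> R).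
Local Notation string_cos := (@string_cos R).
Local Notation level_angle := (@level_angle R).
Local Notation lap := (@laplacian R Gamma).
Local Notation green := (@green R Gamma).
Local Notation mean := (@walk_mean R Gamma).

Definition even_string w : bool := ~~ last true w.

Lemma size_Gamma w : (0 < size (Gamma w))%N.
Proof. by []. Qed.

Lemma size_remove_last w : size (remove_last w) = (size w).-1.
Proof.
by rewrite /remove_last size_take; case: w => //= b w; rewrite ltnSn.
Qed.

Lemma string_cos_remove_last m w : even_string w ->
  string_cos m (remove_last w) = string_cos m w.
Proof.
case: (lastP w) => // u b; rewrite /even_string last_rcons remove_last_rcons.
by case: b => // _; rewrite string_cos_rcons0.
Qed.

(** Vertical edges append or remove a 0 and keep the position, so they act on [a] alone; horizontal
    edges multiply the mode by minus its symbol. *)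
Lemma laplacian_radial a m w :
  lap (fun v => a (size v) * string_cos m v) w =
  ((a (size w).+1 - a (size w)) + (even_string w)%:R *
    (a (size w).-1 - a (size w))
   - a (size w) * symbol (level_angle m (size w))) * string_cos m w.
Proof.
rewrite /laplacian /Gamma big_cat !big_cons big_nil.
rewrite size_add1 size_sub1 size_rcons string_cos_rcons0.
have E := string_cos_add1_sub1 R m w; rewrite [X in X = _]/=.
have -> : a (size w) * string_cos m (add1 w) - a (size w) * string_cos m w +
   (a (size w) * string_cos m (sub1 w) - a (size w) * string_cos m w +
    (a (size w).+1 * string_cos m w - a (size w) * string_cos m w + 0)) =
   a (size w) * (string_cos m (add1 w) + string_cos m (sub1 w)) - 2 * a (size w)
     * string_cos m w +
    (a (size w).+1 - a (size w)) * string_cos m w by ring.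
rewrite E -/(even_string w) /symbol.
case: ifP => [lw|/negbT lw].
  by rewrite big_nil /even_string lw /=; ring.
rewrite big_seq1 size_remove_last string_cos_remove_last// [even_string w]lw /=.
ring.
Qed.

(* Strings ending in 1 have no upward move, so their weight can be smaller; this
   beats the upward move of the strings ending in 0. *)
Definition lyapunov_Gamma w : R := (3 / 4) ^+ size w *
  (if last true w then 15 / 16 else 1).

Lemma lyapunov_Gamma_ge w : 15 / 16 * (3 / 4) ^+ size w <= lyapunov_Gamma w.
Proof.
by rewrite /lyapunov_Gamma mulrC ler_pM2l ?exprn_gt0//; case: ifP => _; lra.
Qed.

Lemma lyapunov_Gamma_gt0 w : 0 < lyapunov_Gamma w.
Proof.
by apply: lt_le_trans (lyapunov_Gamma_ge w); rewrite mulr_gt0// exprn_gt0.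
Qed.

Lemma lyapunov_Gamma_le w : lyapunov_Gamma w <= (3 / 4) ^+ size w.
Proof.
by rewrite /lyapunov_Gamma ler_piMr ?exprn_ge0//; case: ifP => _; lra.
Qed.

Lemma lyapunov_Gamma_super w : avg Gamma lyapunov_Gamma w <=
  99 / 100 * lyapunov_Gamma w.
Proof.
rewrite /avg ler_pdivrMr ?ltr0n ?size_Gamma//.
case: (lastP w) => [|u [|]].
- rewrite /Gamma /= !big_cons big_nil add1_nil sub1_nil /lyapunov_Gamma /=.
  by rewrite expr1 expr0; lra.
- rewrite /Gamma last_rcons /= !big_cons big_nil add1_rcons1 sub1_rcons1
    /lyapunov_Gamma.
  rewrite !last_rcons !size_rcons size_add1 !exprS /=.
  have z0 : (0 : R) < (3 / 4) ^+ size u by rewrite exprn_gt0.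
  by lra.
- rewrite /Gamma last_rcons /= !big_cons big_nil add1_rcons0 sub1_rcons0.
  rewrite remove_last_rcons {1 2 3 5}/lyapunov_Gamma.
  rewrite !last_rcons !size_rcons size_sub1 !exprS.
  have z0 : (0 : R) < (3 / 4) ^+ size u by rewrite exprn_gt0.
  have := lyapunov_Gamma_le u; rewrite /=.
  by lra.
Qed.

Local Notation dom := (dominated lyapunov_Gamma).
Local Notation rho := (99 / 100 : R).

Let rho_ge0 : 0 <= rho. Proof. by lra. Qed.
Let rho_lt1 : rho < 1. Proof. by lra. Qed.
Lemma lyapunov_Gamma_ge0 w : 0 <= lyapunov_Gamma w.
Proof.
exact/ltW/lyapunov_Gamma_gt0.
Qed.

Definition radial a m w : R := a (size w) * string_cos m w.

(** The cost of dominating a function bounded by 1 and supported on depth at most [n]: 16/15 undoes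
    the smaller weight of strings ending in 1, and (4/3)^n the decay. *)
Local Notation lc n := (16 / 15 * (4 / 3) ^+ n : R).

Let lc_ge0 n : 0 <= lc n.
Proof. by apply: mulr_ge0 => //; apply: exprn_ge0; lra. Qed.

Lemma dominated_radial a m n (K : R) : 0 <= K ->
  (forall k, `|a k| <= K * (k <= n)%:R) ->
  dom (radial a m) (K * (16 / 15 * (4 / 3) ^+ n)).
Proof.
move=> K0 aK w; rewrite /radial normrM.
apply: (@le_trans _ _ (K * (size w <= n)%:R)).
  by rewrite -[leRHS]mulr1 ler_pM// string_cos_norm_le1.
case: leqP => wn; last first.
  by rewrite mulr0 mulr_ge0 ?lyapunov_Gamma_ge0// mulr_ge0// lc_ge0.
rewrite mulr1 -mulrA ler_peMr// -mulrA.
have e : (4 / 3) ^+ n * (3 / 4) ^+ n = 1 :> R.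
  rewrite -exprMn; have -> : 4 / 3 * (3 / 4) = 1 :> R by lra.
  exact: expr1n.
have : (3 / 4) ^+ n <= (3 / 4) ^+ size w :> R by apply: ler_wiXn2l => //; lra.
have : 0 <= (4 / 3) ^+ n :> R by apply: exprn_ge0; lra.
have := lyapunov_Gamma_ge w.
move: e; move: (_ ^+ n) (_ ^+ n) (_ ^+ size w) (lyapunov_Gamma w) =>
  y x z t xy tz x0 yz.
have : x * (15 / 16 * y) <= x * t by apply: ler_wpM2l => //; lra.
by rewrite mulrCA xy; lra.
Qed.

Lemma dominatedD g u c d : dom g c -> dom u d ->
  dom (fun w => g w + u w) (c + d).
Proof.
by move=> gc ud w; rewrite mulrDl (le_trans (ler_normD _ _))// lerD.
Qed.

Lemma dominatedZ g (x : R) c : dom g c -> dom (fun w => x * g w) (`|x| * c).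
Proof. by move=> gc w; rewrite normrM -mulrA ler_wpM2l. Qed.

Lemma dominated_green g c : 0 <= c -> dom g c -> `|green g| <= 100 * c.
Proof.
move=> c0 gc; apply: le_trans (green_norm size_Gamma rho_ge0 rho_lt1
  lyapunov_Gamma_ge0 lyapunov_Gamma_super c0 gc) _.
have -> : (1 - 99 / 100)^-1 = 100 :> R by field.
by rewrite /lyapunov_Gamma /= expr0; lra.
Qed.

(** * Potential and current of one Fourier mode, level by level *)

Definition level_cos n m := radial (fun k => (k == n)%:R) m.
Definition even_level_cos n m w : R := (even_string w)%:R * level_cos n m w.
Definition below_level_cos n m := radial (fun k => (k <= n)%:R) m.
Definition symbol_below n m := radial (fun k =>
  symbol (level_angle m k) * (k <= n)%:R) m.

Lemma dom_level_cos n m : dom (level_cos n m) (lc n).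
Proof.
rewrite -[lc n]mul1r; apply: dominated_radial => // k; rewrite mul1r.
by case: eqP => [->|_]; rewrite ?leqnn ?normr1// normr0.
Qed.

Lemma dom_below_level_cos n m : dom (below_level_cos n m) (lc n).
Proof.
rewrite -[lc n]mul1r; apply: dominated_radial => // k; rewrite mul1r.
by rewrite normr_nat.
Qed.

Lemma dom_symbol_below n m : dom (symbol_below n m) (4 * lc n).
Proof.
apply: dominated_radial => // k.
by rewrite normrM normr_nat ler_wpM2r// ger0_norm ?symbol_ge0 ?symbol_le4.
Qed.

Lemma dom_even_level_cos n m : dom (even_level_cos n m) (lc n).
Proof.
move=> w; apply: le_trans (dom_level_cos n m w);
  rewrite /even_level_cos normrM normr_nat.
by rewrite ler_piMl// lern1 leq_b1.
Qed.

Let gD := greenD size_Gamma rho_ge0 rho_lt1 lyapunov_Gamma_ge0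
  lyapunov_Gamma_super.
Let gZ := greenZ size_Gamma rho_ge0 rho_lt1 lyapunov_Gamma_ge0
  lyapunov_Gamma_super.
Let gL := green_laplacian size_Gamma rho_ge0 rho_lt1 lyapunov_Gamma_ge0
  lyapunov_Gamma_super.

(** Mode [m] of the potential on level [n], and of the current leaving it downwards: the unit source
    at the root has every mode equal to 1, and each level down to [n] drains its symbol times its
    potential. *)
Definition level_potential n m : R := green (level_cos n m).
Definition level_current n m : R := 1 - green (symbol_below n m).

Lemma laplacian_below_level_cos n m :
  lap (below_level_cos n m) = (fun w =>
    (even_level_cos n.+1 m w + -1 * level_cos n m w) + -1 * symbol_below n m w).
Proof.
apply/funext => w; rewrite /below_level_cos laplacian_radial /even_level_cos
  /level_cos /symbol_below /radial.
have -> : ((size w).+1 <= n)%:R - (size w <= n)%:R = - (size w == n)%:R :> R.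
  by case: ltngtP => _ /=; rewrite ?subrr ?oppr0// sub0r.
have -> : ((size w).-1 <= n)%:R - (size w <= n)%:R = (size w == n.+1)%:R :> R.
  case: (size w) => [|s]; first by rewrite subrr.
  by rewrite eqSS /=; case: ltngtP => _ /=; rewrite ?subrr ?subr0.
by ring.
Qed.

(* Adding 2 ^ n to the frequency multiplies the cosine at a string of length
   n + 1 by the sign of its last digit. *)
Lemma even_level_cos_half n m : even_level_cos n.+1 m =
  (fun w => 2^-1 * level_cos n.+1 m w + 2^-1 * level_cos n.+1 (m + 2 ^ n) w).
Proof.
apply/funext => w; rewrite /even_level_cos /level_cos /radial /even_string.
case: (lastP w) => [|u b]; first by rewrite /= !mul0r !mulr0 addr0.
rewrite last_rcons size_rcons eqSS.
have [<-|_] := eqVneq (size u) n; last by rewrite !mul0r !mulr0 addr0.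
by rewrite string_cos_half; case: b; rewrite /= ?expr0 ?expr1 ?mulN1r ?mul1r;
  lra.
Qed.

Lemma green_even_level_cos n m : green (even_level_cos n.+1 m) =
  (level_potential n.+1 m + level_potential n.+1 (m + 2 ^ n)) / 2.
Proof.
rewrite even_level_cos_half.
rewrite (gD _ (dominatedZ 2^-1 (dom_level_cos n.+1 m))
  _ (dominatedZ 2^-1 (dom_level_cos n.+1 _)));
  do ?by rewrite mulr_ge0// lc_ge0.
rewrite (gZ _ (lc_ge0 _) (dom_level_cos n.+1 m)) (gZ
  _ (lc_ge0 _) (dom_level_cos n.+1 _)) /level_potential.
by lra.
Qed.

(** Ohm's law on the edges between levels [n] and [n + 1], obtained by testing the potential against
    the mode cut off below level [n]. The lower ends of these edges are the even strings, whence the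
    mean over two aliases. *)
Lemma level_current_flow n m : level_current n m =
  level_potential n m - (level_potential n.+1 m +
    level_potential n.+1 (m + 2 ^ n)) / 2.
Proof.
rewrite -green_even_level_cos.
have l1 := lc_ge0 n; have l2 := lc_ge0 n.+1.
have d1 := dominatedZ (-1) (dom_level_cos n m); have d2 :=
  dominatedZ (-1) (dom_symbol_below n m).
have d12 := dominatedD (dom_even_level_cos n.+1 m) d1.
have d := dominatedD d12 d2.
have p1 : 0 <= `|-1 : R| * lc n by rewrite mulr_ge0.
have p2 : 0 <= `|-1 : R| * (4 * lc n) by rewrite !mulr_ge0.
have p12 : 0 <= lc n.+1 + `|-1 : R| * lc n by rewrite addr_ge0.
have p : 0 <= lc n.+1 + `|-1 : R| * lc n + `|-1 : R| * (4 * lc n)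
  by rewrite addr_ge0.
rewrite -laplacian_below_level_cos in d.
have := gL p d l1 (dom_below_level_cos n m).
rewrite laplacian_below_level_cos (gD p12 d12 p2 d2)
  (gD l2 (dom_even_level_cos _ _) p1 d1).
rewrite (gZ _ l1 (dom_level_cos n m)) (gZ
  _ (mulr_ge0 _ l1) (dom_symbol_below n m))//.
have -> : below_level_cos n m [::] =
  1 by rewrite /below_level_cos /radial string_cos_nil mulr1.
by rewrite /level_current /level_potential; lra.
Qed.

Lemma level_currentS n m : level_current n.+1 m =
  level_current n m - symbol (level_angle m n.+1) * level_potential n.+1 m.
Proof.
have l2 := lc_ge0 n.+1.
have -> : level_current n.+1 m = 1 -
  green (fun w => symbol_below n m w + symbol (level_angle m n.+1) *
    level_cos n.+1 m w).
  congr (1 - green _); apply/funext => w;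
    rewrite /symbol_below /level_cos /radial.
  rewrite leq_eqVlt ltnS; case: eqP => [->|_] /=; last
    by rewrite !mul0r mulr0 addr0.
  by rewrite ltnn mulr0 mul0r add0r mulr1 mul1r.
rewrite (gD _ (dom_symbol_below n m) _ (dominatedZ _ (dom_level_cos n.+1 m)));
  do ?by rewrite mulr_ge0// lc_ge0.
by rewrite (gZ _ l2 (dom_level_cos n.+1 m)) opprD addrA.
Qed.

Lemma level_current_shift n m : level_current n (m + 2 ^ n) = level_current n m.
Proof.
congr (1 - green _); apply/funext => w; rewrite /symbol_below /radial.
case: leqP => wn; last by rewrite !mulr0 !mul0r.
by rewrite symbol_level_angle_shift// string_cos_shift.
Qed.

Lemma level_current0 m : level_current 0 m = 1.
Proof.
have -> : level_current 0 m = 1 - green (fun w => 0 * level_cos 0 m w).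
  congr (1 - green _); apply/funext => w;
    rewrite /symbol_below /radial leqn0 mul0r.
  case: eqP => [->|_]; last by rewrite mulr0 mul0r.
  by rewrite /level_angle expr0 divr1 -[2 * pi * _]add0r symbolDn2pi symbol0
    !mul0r.
by rewrite (gZ _ (lc_ge0 0) (dom_level_cos 0 m)) mul0r subr0.
Qed.

(** Here 107 rounds up 100 * 16/15, where 100 is 1 / (1 - 99/100). *)
Lemma level_potential_bound n m : `|level_potential n m| <= 107 * (4 / 3) ^+ n.
Proof.
apply: le_trans (dominated_green (lc_ge0 n) (dom_level_cos n m)) _.
have : 0 <= (4 / 3) ^+ n :> R by apply: exprn_ge0; lra.
by lra.
Qed.

Lemma level_angleS m n : level_angle m n.+1 = level_angle m n / 2.
Proof. by rewrite /level_angle exprS; field; rewrite expf_neq0. Qed.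

Lemma level_angleS_half m n : level_angle (m + 2 ^ n) n.+1 =
  level_angle m n / 2 + pi.
Proof. by rewrite /level_angle exprS natrD natrX; field; rewrite expf_neq0. Qed.

(* Below level n the graph is invariant under translation by 2^-n, so each mode
   of the potential on level n should be a fixed multiple of the same mode of
   the current leaving level n. The recursion contracts upwards by 2 / 3, while
   the potentials grow downwards at most like (4 / 3) ^ n, so the error is 0. *)
Definition response_error n m : R :=
  level_potential n m - response (level_angle m n) * level_current n m.

(** The difference of [level_current_flow] and [response_feedback]: with I the current leaving level
    [n] and V' a potential on level [n + 1], [transfer] times the error below is V' minus [damp]
    times I. *)
Lemma response_error_rec n m : response_error n m =
  (transfer (level_angle m n.+1) * response_error n.+1 m +
   transfer (level_angle (m + 2 ^ n) n.+1) * response_error n.+1 (m + 2 ^ n)) /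
     2.
Proof.
rewrite /response_error !level_currentS level_current_shift.
have -> : level_potential n m = level_current n m +
  (level_potential n.+1 m + level_potential n.+1 (m + 2 ^ n)) / 2
    by rewrite level_current_flow subrK.
rewrite (response_feedback (level_angle m n)) /feedback -level_angleS_half
  -level_angleS /transfer /damp.
have := transfer_den (level_angle m n.+1); have :=
  transfer_den (level_angle (m + 2 ^ n) n.+1).
by move=> d1 d2; field; rewrite !gt_eqF.
Qed.

(* The two angles differ by pi, so one of their symbols is at least 2 and the
   corresponding transfer factor is at most 1 / 3. *)
Lemma response_error_contract n (X : R) :
  (forall m, `|response_error n.+1 m| <= X) ->
  forall m, `|response_error n m| <= 2 / 3 * X.
Proof.
move=> H m; rewrite response_error_rec normrM [`|2^-1|]ger0_norm//.
have X0 : 0 <= X by apply: le_trans (H 0%N).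
set t1 := level_angle m n.+1; set t2 := level_angle (m + 2 ^ n) n.+1.
have l12 : symbol t2 = 4 - symbol t1 by rewrite /t2 level_angleS_half
  /t1 level_angleS symbolDpi.
have third (t : R) : 2 <= symbol t -> transfer t <= 3^-1.
  move=> l2; rewrite lef_pV2 ?posrE ?transfer_den//.
  have /andP[b1 _] := response_bound t.
  have : 2 * 1 <= symbol t * response t by apply: ler_pM.
  by lra.
have phi2 : transfer t1 + transfer t2 <= 4 / 3.
  have := transfer_le1 t1; have := transfer_le1 t2.
  have [l2|l2] := leP 2 (symbol t1); first by have := third _ l2; lra.
  have l2' : 2 <= symbol t2 by rewrite l12; lra.
  by have := third _ l2'; lra.
have h1 : `|transfer t1 * response_error n.+1 m| <= transfer t1 * X.
  by rewrite normrM ger0_norm ?ler_wpM2l// ltW// transfer_gt0.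
have h2 : `|transfer t2 * response_error n.+1 (m + 2 ^ n)| <= transfer t2 * X.
  by rewrite normrM ger0_norm ?ler_wpM2l// ltW// transfer_gt0.
have h3 : `|transfer t1 * response_error n.+1 m + transfer t2 *
  response_error n.+1 (m + 2 ^ n)| <= 4 / 3 * X.
  rewrite (le_trans (ler_normD _ _))// (le_trans (lerD h1 h2))//.
  by rewrite -mulrDl ler_wpM2r.
by lra.
Qed.

(** Crude constants: 107 + 107 * 4/3 < 250 bounds the current, and 107 + 5/2 * 250 < 1000. *)
Lemma response_error_bound n m : `|response_error n m| <= 1000 * (4 / 3) ^+ n.
Proof.
have x0 : 0 <= (4 / 3) ^+ n :> R by apply: exprn_ge0; lra.
have := level_potential_bound n m; have := level_potential_bound n.+1 m; have :=
  level_potential_bound n.+1 (m + 2 ^ n).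
rewrite exprS => b1 b2 b3.
have bf : `|level_current n m| <= 250 * (4 / 3) ^+ n.
  rewrite level_current_flow; apply: le_trans (ler_normB _ _) _.
  rewrite normrM [`|2^-1|]ger0_norm//.
  have := ler_normD (level_potential n.+1 m) (level_potential n.+1 (m + 2 ^ n)).
  by lra.
rewrite /response_error; apply: le_trans (ler_normB _ _) _.
rewrite normrM (ger0_norm (response_ge0 _)).
have /andP[_ B2] := response_bound (level_angle m n).
have : response (level_angle m n) * `|level_current n m| <=
  5 / 2 * (250 * (4 / 3) ^+ n).
  by apply: ler_pM => //; exact: response_ge0.
by lra.
Qed.

(** Each use of the contraction moves one level down, where the bound is larger by 4/3; the net gain
    is 2/3 * 4/3 = 8/9. *)
Lemma response_error_decay j n m : `|response_error n m| <=
  1000 * (4 / 3) ^+ n * (8 / 9) ^+ j.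
Proof.
elim: j n m => [|j IHj] n m; first by rewrite expr0 mulr1 response_error_bound.
have := @response_error_contract n _ (IHj n.+1) m.
rewrite !exprS; set x := _ ^+ n; set y := _ ^+ j.
by have -> : 2 / 3 * (1000 * (4 / 3 * x) * y) = 1000 * x * (8 / 9 * y) by field.
Qed.

Lemma response_error_eq0 n m : response_error n m = 0.
Proof.
have c : geometric (1000 * (4 / 3) ^+ n : R) (8 / 9) @ \oo --> (0 : R).
  by apply: cvg_geometric; rewrite ger0_norm; lra.
apply/eqP; rewrite -normr_le0.
have -> : 0 = limn (geometric (1000 * (4 / 3) ^+ n : R) (8 / 9)).
  by rewrite (cvg_lim _ c).
apply: limr_ge; first exact: cvgP c.
by near=> j; exact: response_error_decay.
Unshelve. all: by end_near. Qed.

Lemma level_current_transfer n m : level_current n.+1 m =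
  level_current n m * transfer (level_angle m n.+1).
Proof.
have /eqP := response_error_eq0 n.+1 m; rewrite subr_eq0 => /eqP vE.
have := level_currentS n m; rewrite vE => E.
have -> : level_current n m = level_current n.+1 m *
  (1 + symbol (level_angle m n.+1) * response (level_angle m n.+1)).
  by rewrite [in LHS](_ : level_current n m =
    level_current n.+1 m + symbol (level_angle m n.+1) *
      (response (level_angle m n.+1) * level_current n.+1 m));
        [ring|rewrite {1}E; ring].
by rewrite /transfer mulfK// gt_eqF// transfer_den.
Qed.

Lemma level_currentE n m : level_current n m = transfer_prod n m%:R.
Proof.
elim: n => [|n IHn]; first by rewrite level_current0 /transfer_prod big_ord0.
by rewrite level_current_transfer transfer_prod_recr IHn.
Qed.

(** * Fourier coefficients as infinite products *)

Definition symbol_tail n m := radial (fun k =>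
  symbol (level_angle m k) * (n <= k)%:R) m.

Lemma symbol_level_angle_le m k : symbol (level_angle m k) <=
  4 * pi * m%:R * 2^-1 ^+ k.
Proof.
have := symbol_lipschitz (level_angle m k) 0;
  rewrite symbol0 !subr0 ger0_norm ?symbol_ge0//.
rewrite level_angleE ger0_norm ?mulr_ge0 ?pi_ge0 ?exprn_ge0//.
by move=> h; apply: le_trans h _; rewrite le_eqVlt; apply/orP; left; apply/eqP;
  ring.
Qed.

(** Since 1/2 = 2/3 * 3/4, the bound 4 pi m 2^-k on the symbol splits into a tail factor (2/3)^k and
    a factor (3/4)^k, itself at most twice the Lyapunov function. *)
Local Notation tc n m := (8 * pi * m%:R * (2 / 3) ^+ n : R).

Let tc_ge0 n m : 0 <= tc n m.
Proof. by rewrite !mulr_ge0 ?pi_ge0// exprn_ge0; lra. Qed.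

Lemma dom_symbol_tail n m : dom (symbol_tail n m) (tc n m).
Proof.
move=> w; rewrite /symbol_tail /radial !normrM normr_nat.
case: leqP => nw; last by rewrite mulr0 mul0r mulr_ge0 ?tc_ge0
  ?lyapunov_Gamma_ge0.
rewrite mulr1 (ger0_norm (symbol_ge0 _)).
apply: (@le_trans _ _ (symbol (level_angle m (size w)))).
  by rewrite ler_piMr ?symbol_ge0 ?string_cos_norm_le1.
apply: le_trans (symbol_level_angle_le _ _) _.
have -> : 2^-1 ^+ size w = (2 / 3) ^+ size w * (3 / 4) ^+ size w :> R.
  by rewrite -exprMn; congr (_ ^+ _); field.
have h1 : (2 / 3) ^+ size w <= (2 / 3) ^+ n :> R
  by apply: ler_wiXn2l => //; lra.
have h2 := lyapunov_Gamma_ge w.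
have h3 : 0 <= (2 / 3) ^+ size w :> R by apply: exprn_ge0; lra.
have h4 : 0 <= (3 / 4) ^+ size w :> R by apply: exprn_ge0; lra.
have h5 : (2 / 3) ^+ size w * (3 / 4) ^+ size w <=
  (2 / 3) ^+ n * (2 * lyapunov_Gamma w).
  by apply: ler_pM => //; lra.
have h6 : 0 <= 4 * pi * m%:R :> R by rewrite !mulr_ge0 ?pi_ge0.
have := ler_wpM2l h6 h5.
by move=> h; apply: le_trans h _; rewrite le_eqVlt; apply/orP; left; apply/eqP;
  ring.
Qed.

(** The current left in mode [m] after the drain of all levels, that is, the limit of
    [level_current] in [n]. *)
Definition fourier_Gamma m : R := 1 - green (symbol_tail 0 m).

Lemma laplacian_string_cos m : lap (string_cos m) =
  (fun w => -1 * symbol_tail 0 m w).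
Proof.
apply/funext => w; have := laplacian_radial (fun=> 1) m w.
rewrite (_ : (fun u => 1 * string_cos m u) = string_cos m); last first.
  by apply/funext => u; rewrite mul1r.
by move=> ->; rewrite /symbol_tail /radial leq0n subrr mulr0 mulr1; ring.
Qed.

Lemma walk_mean_Gamma_cvg m : mean ^~ (string_cos m) @ \oo --> fourier_Gamma m.
Proof.
have d := dominatedZ (-1) (dom_symbol_tail 0 m).
have p : 0 <= `|-1 : R| * tc 0 m by rewrite mulr_ge0 ?tc_ge0.
have -> : fourier_Gamma m = string_cos m [::] + green (lap (string_cos m)).
  rewrite laplacian_string_cos (gZ _ (tc_ge0 0 m) (dom_symbol_tail 0 m))
    string_cos_nil.
  by rewrite mulN1r.
apply: (dominated_laplacian_cvg size_Gamma rho_ge0 rho_lt1 lyapunov_Gamma_ge0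
  lyapunov_Gamma_super p).
by rewrite laplacian_string_cos.
Qed.

Lemma fourier_Gamma_dist n m : `|fourier_Gamma m - transfer_prod n m%:R| <=
  100 * tc n.+1 m.
Proof.
have -> : fourier_Gamma m - transfer_prod n m%:R = - green (symbol_tail n.+1 m).
  rewrite -level_currentE /fourier_Gamma /level_current.
  have -> : symbol_tail 0 m = (fun w =>
    symbol_below n m w + symbol_tail n.+1 m w).
    apply/funext => w; rewrite /symbol_tail /symbol_below /radial leq0n.
    by case: (ltnP n (size w)) => _; rewrite ?mulr0 ?mul0r ?add0r ?addr0 ?mulr1.
  have l4 : 0 <= 4 * lc n by rewrite mulr_ge0 ?lc_ge0.
  rewrite (gD l4 (dom_symbol_below n m) (tc_ge0 n.+1 m)
    (dom_symbol_tail n.+1 m)); ring.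
by rewrite normrN; apply: dominated_green;
  [exact: tc_ge0|exact: dom_symbol_tail].
Qed.

Lemma transfer_prod_cvg m : (fun n => transfer_prod n m%:R) @ \oo -->
  fourier_Gamma m.
Proof.
have c : geometric (100 * (8 * pi * m%:R * (2 / 3)) : R) (2 / 3) @ \oo -->
  (0 : R).
  by apply: cvg_geometric; rewrite ger0_norm; lra.
have c' : (fun n => fourier_Gamma m - transfer_prod n m%:R) @ \oo --> (0 : R).
  apply/norm_cvg0P; apply: squeeze_cvgr (cvg_cst 0) c; near=> n.
  rewrite normr_ge0 (le_trans (fourier_Gamma_dist n m))// /geometric /= exprS.
  by rewrite le_eqVlt; apply/orP; left; apply/eqP; ring.
have -> : (fun n => transfer_prod n m%:R) =
  (fun n => fourier_Gamma m - (fourier_Gamma m - transfer_prod n m%:R)).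
  by apply/funext => n; ring.
by rewrite -[X in _ --> X]subr0; apply: cvgB => //; exact: cvg_cst.
Unshelve. all: by end_near. Qed.

Lemma fourier_Gamma_double m : fourier_Gamma (2 * m) = fourier_Gamma m.
Proof.
have c : (fun n => transfer_prod n.+1 (2 * m)%:R) @ \oo -->
  fourier_Gamma (2 * m).
  by rewrite (cvg_shiftS (fun n => transfer_prod n (2 * m)%:R)); exact:
    transfer_prod_cvg.
rewrite -(cvg_lim (@norm_hausdorff _ _) c)
  -[RHS](cvg_lim (@norm_hausdorff _ _) (@transfer_prod_cvg m)).
by congr (limn _); apply/funext => n; rewrite transfer_prod_double.
Qed.

Lemma fourier_Gamma_expn k m : fourier_Gamma (2 ^ k * m) = fourier_Gamma m.
Proof.
elim: k => [|k IHk]; first by rewrite mul1n.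
by rewrite expnS -mulnA fourier_Gamma_double.
Qed.

(** After finitely many factors the remaining product has an argument so close to 0 that it is at
    least 1/2. *)
Lemma fourier_Gamma1_gt0 : 0 < fourier_Gamma 1.
Proof.
have [K hK] : exists K, 110 * pi * 2^-1 ^+ K <= 2^-1 :> R.
  have c : geometric (110 * pi : R) 2^-1 @ \oo --> (0 : R).
    by apply: cvg_geometric; rewrite ger0_norm; lra.
  have half_gt0 : (0 : R) < 2^-1 by rewrite invr_gt0.
  have [K _ H] := cvgr_le _ c _ half_gt0.
  by exists K; have := H K (leqnn K).
have lb n : transfer_prod K 1 / 2 <= transfer_prod (K + n) (1%:R : R).
  rewrite transfer_prodD ler_pM2l ?transfer_prod_gt0//.
  have := transfer_prod_lipschitz n (0 : R) (1 / 2 ^+ K);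
    rewrite transfer_prod0 sub0r normrN.
  rewrite [X in _ <= _ * X]ger0_norm ?divr_ge0 ?exprn_ge0// div1r -exprVn => h.
  by have := ler_norm (1 - transfer_prod n (2^-1 ^+ K : R)); lra.
apply: (@lt_le_trans _ _ (transfer_prod K 1 / 2)); first
  by rewrite divr_gt0 ?transfer_prod_gt0.
rewrite -(cvg_lim (@norm_hausdorff _ _) (@transfer_prod_cvg 1)).
apply: limr_ge; first exact: cvgP (@transfer_prod_cvg 1).
by exists K => // n /= Kn; rewrite -(subnKC Kn).
Qed.

Lemma fourier_Gamma_shift d (m : nat) (e : R) : e = 1 \/ e = -1 ->
  m%:R = 2 ^+ d + e -> `|fourier_Gamma m - transfer_prod d 1 * fourier_Gamma 1|
    <= 110 * pi * 2^-1 ^+ d.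
Proof.
move=> e1 mE.
have c : (fun n => `|transfer_prod (n + d) m%:R - transfer_prod d 1 *
  transfer_prod n 1%:R|) @ \oo -->
    `|fourier_Gamma m - transfer_prod d 1 * fourier_Gamma 1|.
  apply: cvg_norm; apply: cvgB.
    by rewrite (cvg_shiftn d (fun n => transfer_prod n m%:R)); exact:
      transfer_prod_cvg.
  by apply: cvgMl_tmp; exact: transfer_prod_cvg.
rewrite -(cvg_lim (@norm_hausdorff _ _) c).
apply: limr_le; first exact: cvgP c.
near=> n; rewrite mE addnC transfer_prod_shift// -mulrBr normrM gtr0_norm
  ?transfer_prod_gt0//.
have h := transfer_prod_lipschitz n (1 + e / 2 ^+ d) 1.
apply: (@le_trans _ _ (`|transfer_prod n (1 + e / 2 ^+ d) -
  transfer_prod n 1|)).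
  by rewrite ler_piMl// transfer_prod_le1.
apply: le_trans h _.
rewrite addrC addKr normrM normfV normrX normr_nat -exprVn.
by case: e1 => ->; rewrite ?normrN normr1 mul1r.
Unshelve. all: by end_near. Qed.

Lemma fourier_Gamma_mixing (s : nat -> nat) (e : R) : e = 1 \/ e = -1 ->
  (forall d, (s d)%:R = 2 ^+ d + e) ->
  (fun d => fourier_Gamma (s d)) @ \oo --> fourier_Gamma 1 * fourier_Gamma 1.
Proof.
move=> e1 sE.
have c : geometric (110 * pi : R) 2^-1 @ \oo --> (0 : R).
  by apply: cvg_geometric; rewrite ger0_norm; lra.
have c' : (fun d => fourier_Gamma (s d) - transfer_prod d 1%:R *
  fourier_Gamma 1) @ \oo --> (0 : R).
  apply/norm_cvg0P; apply: squeeze_cvgr (cvg_cst 0) c; near=> d.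
  by rewrite normr_ge0 /= (fourier_Gamma_shift e1).
have -> : (fun d => fourier_Gamma (s d)) =
    (fun d => (fourier_Gamma (s d) - transfer_prod d 1%:R * fourier_Gamma 1) +
      transfer_prod d 1%:R * fourier_Gamma 1).
  by apply/funext => d; rewrite subrK.
rewrite -[X in _ --> X]add0r; apply: cvgD => //.
by apply: cvgMr_tmp; exact: transfer_prod_cvg.
Unshelve. all: by end_near. Qed.

End GammaWalk.

(** * Uniformity of the dual walk *)

Section DualWalk.
Variable R : realType.
Implicit Types (w : bstring) (m n k : nat) (g u : bstring -> R).
Local Notation string_cos := (@string_cos R).
Local Notation level_angle := (@level_angle R).

Lemma size_Gamma_dual w : (0 < size (Gamma_dual w))%N.
Proof. by []. Qed.

(** The sum over one level, peeled from the last digit so that the carry rules apply under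
    induction. *)
Fixpoint levsum n g : R :=
  if n is n'.+1 then levsum n' (fun w => g (rcons w false) + g (rcons w true))
  else g [::].

Lemma eq_levsum n g u : (forall w, size w = n -> g w = u w) ->
  levsum n g = levsum n u.
Proof.
elim: n g u => [|n IHn] g u gu /=; first exact: gu.
by apply: IHn => w wn; rewrite !gu// size_rcons wn.
Qed.

Lemma levsumD n g u : levsum n (fun w => g w + u w) = levsum n g + levsum n u.
Proof.
elim: n g u => [//|n IHn] g u /=; rewrite -IHn; apply: eq_levsum => w _.
by rewrite addrACA.
Qed.

Lemma levsumZ n (x : R) g : levsum n (fun w => x * g w) = x * levsum n g.
Proof.
elim: n g => [//|n IHn] g /=; rewrite -IHn; apply: eq_levsum => w _.
by rewrite mulrDr.
Qed.

Lemma levsum_add1 n g : levsum n (fun w => g (add1 w)) = levsum n g.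
Proof.
elim: n g => [//|n IHn] g /=.
rewrite (@eq_levsum _ _ (fun w => g (rcons w true) + g (rcons (add1 w) false))).
  by rewrite levsumD (IHn (fun w => g (rcons w false))) -levsumD;
    apply: eq_levsum => w _; rewrite addrC.
by move=> w _; rewrite add1_rcons0 add1_rcons1.
Qed.

Lemma levsum_sub1 n g : levsum n (fun w => g (sub1 w)) = levsum n g.
Proof.
elim: n g => [//|n IHn] g /=.
rewrite (@eq_levsum _ _ (fun w => g (rcons (sub1 w) true) + g (rcons w false))).
  by rewrite levsumD (IHn (fun w => g (rcons w true))) -levsumD;
    apply: eq_levsum => w _; rewrite addrC.
by move=> w _; rewrite sub1_rcons0 sub1_rcons1.
Qed.

(* Each move of the dual graph maps the uniform measure on a level to a multiple
   of the uniform measure on a level. *)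
Lemma levsum_avg n g : (forall k, levsum k g = 0) ->
  levsum n (avg Gamma_dual g) = 0.
Proof.
move=> g0.
have E4 : levsum n (fun w => (g (add1 w) + g (sub1 w)) +
    (g (rcons w false) + g (rcons w true))) = 0.
  rewrite levsumD [X in _ + X](g0 n.+1) levsumD levsum_add1 levsum_sub1.
  by rewrite g0 !addr0.
case: n E4 => [|n] E4.
  rewrite /= /avg /Gamma_dual /= !big_cons big_nil; move: E4 => /=.
  by rewrite !addr0 -!addrA => ->; rewrite mul0r.
rewrite (@eq_levsum _ _ (fun w => 5^-1 * (((g (add1 w) + g (sub1 w)) +
    (g (rcons w false) + g (rcons w true))) + g (remove_last w)))).
  rewrite levsumZ levsumD E4 add0r /=.
  rewrite (@eq_levsum _ _ (fun w => 2 * g w)) ?levsumZ ?g0 ?mulr0// => w _.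
  by rewrite !remove_last_rcons; ring.
move=> w wn; rewrite /avg /Gamma_dual; case: w wn => // b w _.
rewrite !big_cons big_nil [size _]/= mulrC; congr (_ * _); ring.
Qed.

Lemma levsum_iter_avg j n g : (forall k, levsum k g = 0) ->
  levsum n (iter j (avg Gamma_dual) g) = 0.
Proof.
by move=> g0; elim: j n => [//|j IHj] n; rewrite iterS; exact: levsum_avg.
Qed.

Lemma cos_neq1 (x : R) : 0 < x < 2 * pi -> cos x != 1.
Proof.
move=> /andP[x0 xpi].
have s0 : 0 < sin (x / 2) by apply: sin_gt0_pi; apply/andP; split; lra.
have -> : cos x = 1 - 2 * sin (x / 2) ^+ 2.
  have -> : cos x = cos ((x / 2) *+ 2) by congr cos; rewrite -mulr_natr; field.
  by rewrite cos_mulr2n cos2sin2 -mulr_natr; ring.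
by rewrite lt_eqF// gtrBl mulr_gt0// exprn_gt0.
Qed.

(** Invariance under both shifts and the eigenvalue relation give S = [cos (level_angle m n)] S for
    the sum S, and the cosine is not 1. *)
Lemma levsum_string_cos n m : (0 < m < 2 ^ n)%N -> levsum n (string_cos m) = 0.
Proof.
move=> /andP[m0 mn]; have pw : 0 < (2 : R) ^+ n by rewrite exprn_gt0.
have c1 : cos (level_angle m n) != 1.
  apply: cos_neq1; rewrite /level_angle; apply/andP; split.
    by rewrite divr_gt0// !mulr_gt0 ?pi_gt0// ltr0n.
  by rewrite ltr_pdivrMr// ltr_pM2l ?mulr_gt0 ?pi_gt0// -natrX ltr_nat.
have E : levsum n (string_cos m) + levsum n (string_cos m) =
    2 * cos (level_angle m n) * levsum n (string_cos m).
  rewrite -{1}(levsum_add1 n (string_cos m)) -{1}(levsum_sub1 n (string_cos m))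
    -levsumD -levsumZ.
  by apply: eq_levsum => w <-; exact: string_cos_add1_sub1.
have /eqP : 2 * (1 - cos (level_angle m n)) * levsum n (string_cos m) = 0.
  by move: E; set s := levsum _ _; lra.
rewrite mulf_eq0 mulf_eq0 subr_eq0 [1 == _]eq_sym (negbTE c1) pnatr_eq0 /=.
by move=> /eqP.
Qed.

(** For a ratio r, the mean over the five moves is (2 + 2 r + 1/r)/5 times the value, which is below
    1 exactly when 1/2 < r < 1; at 3/4 it is 29/30. *)
Definition lyapunov_dual w : R := (3 / 4) ^+ size w.

Lemma lyapunov_dual_super w : avg Gamma_dual lyapunov_dual w <=
  99 / 100 * lyapunov_dual w.
Proof.
rewrite /avg ler_pdivrMr ?ltr0n ?size_Gamma_dual//.
case: w => [|b w].
  rewrite /Gamma_dual /= !big_cons big_nil add1_nil sub1_nil /lyapunov_dual /=.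
  by rewrite expr1 expr0; lra.
rewrite /Gamma_dual !big_cons big_nil /lyapunov_dual size_add1 size_sub1
  !size_rcons.
rewrite size_remove_last [size (b :: w)]/= [(size w).+1.-1]/= !exprS.
have z0 : (0 : R) < (3 / 4) ^+ size w by rewrite exprn_gt0.
rewrite /=; lra.
Qed.

(** On a level whose [2 ^ n] divides [m] the mode is constant, so the shallow levels are split off
    and left behind by the walk. From depth [m] on, [m < 2 ^ m] makes all level sums vanish, and
    this is preserved by the walk. *)
Lemma walk_mean_Gamma_dual_cvg0 m : (0 < m)%N ->
  walk_mean Gamma_dual ^~ (string_cos m) @ \oo --> (0 : R).
Proof.
move=> m0.
pose g w : R := (m <= size w)%N%:R * string_cos m w.
pose r w : R := (size w < m)%N%:R * string_cos m w.
have -> : walk_mean Gamma_dual ^~ (string_cos m) = walk_mean Gamma_dual ^~ r.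
  apply/funext => k; have -> : string_cos m = (fun w => g w + r w).
    apply/funext => w; rewrite /g /r ltnNge.
    by case: leqP => _; rewrite ?mul1r ?mul0r ?addr0 ?add0r.
  rewrite walk_meanD; suff -> : walk_mean Gamma_dual k g = 0 by rewrite add0r.
  (* The expectation is the value at the root, which is the level sum at depth 0. *)
  rewrite -[LHS]/(levsum 0 (iter k (avg Gamma_dual) g)).
  apply: levsum_iter_avg => j.
  rewrite (@eq_levsum _ _ (fun w => (m <= j)%N%:R * string_cos m w));
    last first.
    by move=> w <-.
  rewrite levsumZ; case: leqP => mj; last by rewrite mul0r.
  by rewrite levsum_string_cos ?mulr0// m0 (leq_ltn_trans mj)// ltn_expl.
have d : dominated lyapunov_dual r ((4 / 3) ^+ m).
  move=> w; rewrite /r normrM normr_nat /lyapunov_dual.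
  have x0 : (0 : R) <= (4 / 3) ^+ m by apply: exprn_ge0; lra.
  have y0 : (0 : R) <= (3 / 4) ^+ size w by apply: exprn_ge0; lra.
  case: ltnP => wm; last by rewrite mul0r mulr_ge0.
  rewrite mul1r; apply: le_trans (string_cos_norm_le1 _ _ _) _.
  have e : (4 / 3) ^+ m * (3 / 4) ^+ m = 1 :> R.
    rewrite -exprMn; have -> : 4 / 3 * (3 / 4) = 1 :> R by lra.
    exact: expr1n.
  rewrite -[leLHS]e ler_wpM2l//; apply: ler_wiXn2l => //; try lra.
  exact: ltnW.
have x0 : (0 : R) <= (4 / 3) ^+ m by apply: exprn_ge0; lra.
have rho0 : (0 : R) <= 99 / 100 by lra.
have rho1 : 99 / 100 < 1 :> R by lra.
exact: (walk_mean_dominated_cvg0 size_Gamma_dual rho0 rho1 lyapunov_dual_super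
  x0 d).
Qed.

End DualWalk.

(** * From path probabilities to expectations *)

Section WalkLaw.
Context (R : realType) (d : measure_display) (T : measurableType d).
Variables (P : probability T R) (G : multigraph) (x0 : bstring).
Variable X : nat -> T -> bstring.
Hypothesis G_gt0 : forall w, (0 < size (G w))%N.
Hypothesis walk : simple_random_walk P G x0 X.

Let cyl n (x : nat -> bstring) := [set t | forall k, (k <= n)%N -> X k t = x k].
Let cylp n (x : nat -> bstring) : R :=
  (x 0%N == x0)%:R * \prod_(k < n) step_prob R G (x k) (x k.+1).
Let extend n (x : nat -> bstring) v k := if (k <= n)%N then x k else v.

Lemma measurable_walk n (Y : set bstring) : measurable (X n @^-1` Y).
Proof.
have -> : X n @^-1` Y = \bigcup_w [set t | Y w /\ X n t = w].
  apply/seteqP; split => t /=; first by exists (X n t).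
  by move=> [w _ [? ->]].
apply: countable_bigcupT_measurable => [|w]; first exact: countableP.
have [Yw|nYw] := pselect (Y w).
  rewrite (_ : [set _ | _] = X n @^-1` [set w]); first exact: walk.1.
  by apply/seteqP; split => t /=; [case|split].
rewrite (_ : [set _ | _] = set0); first exact: measurable0.
by apply/seteqP; split => t // -[].
Qed.

Lemma measurable_fun_walk n (g : bstring -> R) D :
  measurable_fun D (fun t => g (X n t)).
Proof.
move=> mD Y _; apply: measurableI => //.
exact: (measurable_walk n (g @^-1` Y)).
Qed.

Let measurable_cyl n x : measurable (cyl n x).
Proof.
rewrite (_ : cyl n x = \bigcap_(k in [set k | (k <= n)%N]) X k @^-1` [set x k]).
  by apply: bigcap_measurableType => k _; exact: measurable_walk.
by apply/seteqP; split.
Qed.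

Let P_cyl n x : P (cyl n x) = (cylp n x)%:E.
Proof. exact: walk.2. Qed.

Let cyl_extend n x v t :
  cyl n.+1 (extend n x v) t <-> cyl n x t /\ X n.+1 t = v.
Proof.
split=> [H|[H <-] k].
  split=> [k kn|]; first by rewrite H 1?leqW// /extend kn.
  by rewrite H// /extend ltnn.
rewrite leq_eqVlt => /predU1P[->|]; first by rewrite /extend ltnn.
by rewrite ltnS /extend => kn; rewrite kn H.
Qed.

Let cylp_extend n x v : cylp n.+1 (extend n x v) =
  cylp n x * step_prob R G (x n) v.
Proof.
rewrite /cylp big_ord_recr /= mulrA /extend leqnn ltnn.
congr (_ * _ * _); apply: eq_bigr => k _.
by rewrite (ltnW (ltn_ord k)) ltn_ord.
Qed.

Lemma sum_step_prob v (g : bstring -> R) :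
  \sum_(w <- undup (G v)) step_prob R G v w * g w = avg G g v.
Proof.
rewrite /avg -[in RHS]big_undup_iterop_count mulr_suml.
apply: eq_bigr => w _; rewrite /step_prob mulrAC; congr (_ * _).
by rewrite mulr_natl.
Qed.

(* The one-step extensions of a cylinder exhaust it up to a null set, because
   their probabilities add up to that of the cylinder. *)
Let integral_cyl n x (f : T -> R) (M : R) : measurable_fun setT f ->
  (forall t, `|f t| <= M) ->
  (\int[P]_(t in cyl n x) (f t)%:E =
   \sum_(v <- undup (G (x n))) \int[P]_(t in cyl n.+1 (extend n x v))
     (f t)%:E)%E.
Proof.
move=> mf fM.
set s := undup _; pose F v := cyl n.+1 (extend n x v).
have mF v : measurable (F v) by exact: measurable_cyl.
have us : uniq s by exact: undup_uniq.
have tF : trivIset [set` s] F.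
  move=> v w _ _ [t [/cyl_extend[_ <-] /cyl_extend[_ <-]]] //.
have mfD D : measurable_fun D f by exact: measurable_funTS.
rewrite -(integral_bigsetU_EFin P mF us tF); last exact/measurable_EFinP.
set D := \big[_/_]_(_ <- _) _.
have mD : measurable D by apply: bigsetU_measurable.
have DA : D `<=` cyl n x.
  by move=> t; rewrite /D -bigcup_seq => -[v _] /cyl_extend[].
have PD : P D = P (cyl n x).
  have := @integral_bigsetU_EFin _ _ _ P _ F (fun=> 1) s mF us tF.
  move=> /(_ (measurable_cst _)).
  rewrite -/D integral_cst// mul1e => ->.
  rewrite P_cyl (eq_bigr (fun v =>
    (cylp n x * step_prob R G (x n) v)%:E)); last first.
    move=> v _; rewrite integral_cst// mul1e.
    by apply: etrans (P_cyl _ _) _; rewrite cylp_extend.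
  rewrite sumEFin -mulr_sumr.
  have := sum_step_prob (x n) (fun=> 1); rewrite -/s.
  under eq_bigr do rewrite mulr1.
  move=> ->; rewrite /avg big_const_seq count_predT iter_addr_0 divff ?mulr1//.
  by rewrite pnatr_eq0 -lt0n.
rewrite (@negligible_integral _ _ _ P (cyl n x) (cyl n x `\` D))//.
- by rewrite setDD setIidr.
- exact: measurableD.
- apply: measurable_bounded_integrable => //; first
    by rewrite [X in (X < _)%E](P_cyl n x) ltry.
  by exists M; split=> [|y My t _]; [exact: num_real|]; exact:
    le_trans (fM t) (ltW My).
- have fD : (P (cyl n x) < +oo)%E by rewrite P_cyl ltry.
  by rewrite measureD// setIidr// [X in (_ - X)%E]PD P_cyl
    [X in (X - _)%E](P_cyl n x) subee.
Qed.

(** The Markov property in integrated form; the induction runs over all cylinders because each step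
    lengthens the cylinder by one. *)
Lemma integral_walk_cyl i n x (g : bstring -> R) (M : R) :
  (forall w, `|g w| <= M) ->
  (\int[P]_(t in cyl n x) (g (X (n + i)%N t))%:E =
   (cylp n x * iter i (avg G) g (x n))%:E)%E.
Proof.
move=> gM; elim: i n x => [|i IHi] n x.
  rewrite addn0 (eq_integral (fun=> (g (x n))%:E)).
    by rewrite integral_cst// [RHS]EFinM -P_cyl muleC.
  by move=> t /set_mem /= ->.
rewrite (@integral_cyl n x _ M)//; last exact: measurable_fun_walk.
under eq_bigr => v _.
  rewrite addnS -addSn IHi cylp_extend {1}/extend ltnn -mulrA.
  over.
by rewrite sumEFin -mulr_sumr sum_step_prob.
Qed.

Lemma integral_walk n (g : bstring -> R) (M : R) : (forall w, `|g w| <= M) ->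
  (\int[P]_t (g (X n t))%:E = (iter n (avg G) g x0)%:E)%E.
Proof.
move=> gM; have c0 : cylp 0 (fun=> x0) = 1.
  by rewrite /cylp big_ord0 eqxx mulr1.
have N0 : P (~` cyl 0 (fun=> x0)) = 0%E.
  by rewrite probability_setC// P_cyl c0 subee.
have := @integral_walk_cyl n 0 (fun=> x0) g M gM; rewrite c0 mul1r add0n => <-.
rewrite (@negligible_integral _ _ _ P setT (~` cyl 0 (fun=> x0)))//.
- by rewrite setTD setCK.
- exact: measurableC.
- apply: measurable_bounded_integrable => //; first
    by rewrite [X in (X < _)%E]probability_setT ltry.
    exact: measurable_fun_walk.
  by exists M; split=> [|y My t _]; [exact: num_real|]; exact:
    le_trans (gM _) (ltW My).
Qed.

End WalkLaw.

(** * Fourier coefficients of harmonic measures *)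

Section FourierCoefficients.
Variable R : realType.
Implicit Types (x y : R) (m n k : nat).

Lemma cosDz2pi x (z : int) : cos (x + 2 * pi * z%:~R) = cos x.
Proof.
case: z => n; first exact: cosDn2pi.
by rewrite NegzE mulrNz mulrN -(cosDn2pi _ n.+1) subrK.
Qed.

Definition circle_cos m x : R := cos (2 * pi * m%:R * x).

Lemma circle_cos_norm_le1 m x : `|circle_cos m x| <= 1.
Proof. exact: cos_max. Qed.

Lemma circle_cos_circle_dist m x y :
  `|circle_cos m x - circle_cos m y| <= 2 * pi * m%:R * circle_dist x y.
Proof.
rewrite /circle_cos /circle_dist; set k := Num.floor _; set t := x - y - _.
have p0 : 0 <= 2 * pi * m%:R :> R by rewrite !mulr_ge0 ?pi_ge0.
have fl := floor_le (x - y); have fu := floorD1_gt (x - y).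
rewrite intrD in fu; rewrite -/k in fl fu.
have bound (s : R) (z : int) : x = y + s + z%:~R ->
    `|cos (2 * pi * m%:R * x) - cos (2 * pi * m%:R * y)| <=
      2 * pi * m%:R * `|s|.
  move=> ->.
  have -> : cos (2 * pi * m%:R * (y + s + z%:~R)) =
    cos (2 * pi * m%:R * (y + s)).
    rewrite -[RHS](cosDz2pi _ (m%:Z * z)); congr cos.
    by rewrite intrM; ring.
  apply: le_trans (cos_lipschitz _ _) _.
  by rewrite -mulrBr addrC addKr normrM (ger0_norm p0).
(* The nearest integer to [x - y] is its floor [k] or [k + 1]. *)
rewrite minEle; case: ifP => _.
  have t0 : 0 <= t by rewrite /t; lra.
  by have := bound t k; rewrite (ger0_norm t0); apply; rewrite /t; ring.
have t0 : 0 <= 1 - t by rewrite /t; lra.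
have := bound (- (1 - t)) (k + 1); rewrite normrN (ger0_norm t0); apply.
by rewrite intrD /t; ring.
Qed.

Lemma continuous_circle_cos m : continuous (circle_cos m).
Proof.
move=> x; apply: (@continuous_comp _ _ _ (fun y => 2 * pi * m%:R * y) cos).
  exact: mulrl_continuous.
exact: continuous_cos.
Qed.

Lemma measurable_circle_cos m :
  measurable_fun [set: measurableTypeR R] (circle_cos m : measurableTypeR R ->
    R).
Proof. by apply: continuous_measurable_fun; exact: continuous_circle_cos. Qed.

(** Dominated convergence with bound 1: [integral_walk] identifies the expectations, and integer
    frequencies make the cosine continuous for [circle_dist]. *)
Lemma harmonic_measure_fourier (G : multigraph)
    (nu : probability (measurableTypeR R) R) m (c : R) :
  (forall w, (0 < size (G w))%N) -> harmonic_measure G nu ->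
  walk_mean G ^~ (string_cos R m) @ \oo --> c ->
  (\int[nu]_x (circle_cos m x)%:E = c%:E)%E.
Proof.
move=> G_gt0 [d [T [P [X [Z [walk Z01 cvgX nuE]]]]]] cvgc.
have mfX n : measurable_fun setT (fun t => string_cos R m (X n t)).
  exact: (measurable_fun_walk walk).
have mfZ : measurable_fun setT (fun t => circle_cos m (Z t)).
  by apply: measurableT_comp => //; exact: measurable_circle_cos.
have [|||_ _ cvgI] := @dominated_convergence _ _ _ P setT measurableT
  (fun n t => (string_cos R m (X n t))%:E) (fun t =>
    (circle_cos m (Z t))%:E) (fun=> 1%E)
  (fun n => (measurable_EFinP _ _).2 (mfX n)) ((measurable_EFinP _ _).2 mfZ).
- apply: filterS cvgX => t cvgt _; apply: cvg_EFin; first exact: nearW.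
  have c0 : (fun n => circle_cos m (position R (X n t)) - circle_cos m (Z t)) @
    \oo --> (0 : R).
    apply/norm_cvg0P.
    apply: (@squeeze_cvgr _ _ _ _ (cst 0) (fun n =>
      2 * pi * m%:R * circle_dist (position R (X n t)) (Z t))).
    - by near=> n; rewrite normr_ge0 circle_cos_circle_dist.
    - exact: cvg_cst.
    - by rewrite -[X in _ --> X](mulr0 (2 * pi * m%:R)); apply: cvgMl_tmp.
  have -> : fine \o (fun n => (string_cos R m (X n t))%:E) =
      (fun n => (circle_cos m (position R (X n t)) - circle_cos m (Z t)) +
        circle_cos m (Z t)).
    by apply/funext => n; rewrite subrK.
  by rewrite -[X in _ --> X]add0r; apply: cvgD => //; exact: cvg_cst.
- exact: finite_measure_integrable_cst.
- by apply: aeW => t n _; rewrite lee_fin string_cos_norm_le1.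
have EI n : (\int[P]_t (string_cos R m (X n t))%:E =
  (walk_mean G n (string_cos R m))%:E)%E.
  exact: (integral_walk G_gt0 walk n (@string_cos_norm_le1 R m)).
have -> : (\int[nu]_x (circle_cos m x)%:E =
  \int[P]_t (circle_cos m (Z t))%:E)%E.
  rewrite (eq_measure_integral (distribution P Z)); last
    by move=> A mA _; exact: nuE.
  rewrite integral_distribution//.
    by apply: measurableT_comp => //; exact: measurable_circle_cos.
  apply: measurable_bounded_integrable => //.
    by rewrite [X in (X < _)%E]probability_setT ltry.
  exists 1; split=> [|y My t _]; first exact: num_real.
  exact: le_trans (circle_cos_norm_le1 _ _) (ltW My).
have cvgI' : (fun n => (walk_mean G n (string_cos R m))%:E) @ \oo --> c%:E.
  by apply: cvg_EFin => //; exact: nearW.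
rewrite -(cvg_lim _ cvgI)// -(cvg_lim _ cvgI')//.
by congr (limn _); apply/funext => n; rewrite /= EI.
Unshelve. all: by end_near. Qed.

End FourierCoefficients.

(** * Singularity from uncorrelated cosines *)

Section BoundedIntegral.
Context (R : realType) (d : measure_display) (T : measurableType d).
Variable P : probability T R.
Implicit Types f g : T -> R.

Definition bounded_measurable f :=
  measurable_fun setT f /\ exists M, forall x, `|f x| <= M.

Lemma bounded_measurable_integrable f : bounded_measurable f ->
  P.-integrable setT (EFin \o f).
Proof.
move=> [mf [M fM]]; apply: measurable_bounded_integrable => //.
  by rewrite [X in (X < _)%E]probability_setT ltry.
exists M; split=> [|y My t _]; first exact: num_real.
exact: le_trans (fM t) (ltW My).
Qed.

Lemma bounded_measurable_cst (a : R) : bounded_measurable (fun=> a).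
Proof. by split; [exact: measurable_cst|exists `|a|]. Qed.

Lemma bounded_measurableD f g : bounded_measurable f -> bounded_measurable g ->
  bounded_measurable (fun x => f x + g x).
Proof.
move=> [mf [M fM]] [mg [N gN]]; split; first exact: measurable_funD.
exists (M + N) => x; rewrite (le_trans (ler_normD _ _))// lerD//.
Qed.

Lemma bounded_measurableM f g : bounded_measurable f -> bounded_measurable g ->
  bounded_measurable (fun x => f x * g x).
Proof.
move=> [mf [M fM]] [mg [N gN]]; split; first exact: measurable_funM.
by exists (M * N) => x; rewrite normrM ler_pM.
Qed.

Lemma bounded_measurable_sum n (F : 'I_n -> T -> R) :
  (forall i, bounded_measurable (F i)) ->
  bounded_measurable (fun x => \sum_i F i x).
Proof.
move=> H; elim: n F H => [|n IHn] F H.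
  by under eq_fun do rewrite big_ord0; exact: bounded_measurable_cst.
under eq_fun do rewrite big_ord_recr.
by apply: bounded_measurableD => //; apply: IHn => i; exact: H.
Qed.

Lemma Rintegral_bsum n (F : 'I_n -> T -> R) :
  (forall i, bounded_measurable (F i)) ->
  \int[P]_x (\sum_i F i x) = \sum_i \int[P]_x F i x.
Proof.
move=> H; elim: n F H => [|n IHn] F H.
  by rewrite big_ord0; under eq_Rintegral do rewrite big_ord0;
    rewrite Rintegral_cst// mul0r.
under eq_Rintegral do rewrite big_ord_recr.
rewrite RintegralD//; do ?exact: bounded_measurable_integrable.
- by rewrite IHn ?big_ord_recr.
- by apply: bounded_measurable_integrable; apply: bounded_measurable_sum.
Qed.

Lemma Rintegral_cst1 (a : R) : \int[P]_x a = a.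
Proof. by rewrite Rintegral_cst// [X in fine X]probability_setT mulr1. Qed.

Lemma chebyshev_bound f (delta e : R) : bounded_measurable f -> 0 < delta ->
  \int[P]_x (f x * f x) <= delta * delta * e ->
  (P [set x | (delta <= `|f x|)%R] <= e%:E)%E.
Proof.
move=> bf d0 le; have [mf _] := bf; set A := [set _ | _].
have mA : measurable A.
  rewrite (_ : A = (fun x => `|f x|) @^-1` `[delta, +oo[).
    rewrite -[_ @^-1` _]setTI; apply: (measurableT_comp _ mf) => //.
  by apply/seteqP; split => x /=; rewrite in_itv/= andbT.
have bA : bounded_measurable (\1_A : T -> R).
  split; first exact: measurable_indic.
  by exists 1 => x; rewrite indicE normr_nat lern1 leq_b1.
have IA : \int[P]_x (\1_A x) = fine (P A).
  by rewrite /Rintegral integral_indic// setIT.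
have dd : 0 < delta * delta by rewrite mulr_gt0.
have fA : P A \is a fin_num by exact: fin_num_measure.
rewrite -(fineK fA) lee_fin -(ler_pM2l dd); apply: le_trans le.
rewrite -IA -RintegralZl//; last exact: bounded_measurable_integrable.
apply: le_Rintegral => //.
- apply: bounded_measurable_integrable.
  by apply: bounded_measurableM => //; exact: bounded_measurable_cst.
- by apply: bounded_measurable_integrable; apply: bounded_measurableM.
move=> x _; rewrite indicE; case: (boolP (x \in A)) => [/set_mem|] /= xA.
  have : delta * delta <= `|f x| * `|f x| by apply: ler_pM => //; exact: ltW.
  by rewrite mulr1 -normrM ger0_norm// -expr2 sqr_ge0.
by rewrite mulr0 -expr2 sqr_ge0.
Qed.

End BoundedIntegral.

Section Singularity.
Variable R : realType.
Implicit Types (c : nat -> R) (a : R).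

Definition frequency N D (x : R) : R :=
  (\sum_(i < N) circle_cos (2 ^ (i * D)) x) / N%:R.

(* With c m the integral of cos (2 pi m x), the quotient by 2 is the integral of
   cos (2 pi 2^(j D) x) cos (2 pi 2^(i D) x). *)
Definition uncorrelated c a := (forall k, c (2 ^ k)%N = a) /\
  forall eta, 0 < eta -> exists D0, forall D, (D0 <= D)%N -> forall i j,
    (i < j)%N ->
    (c (2 ^ (j * D) + 2 ^ (i * D))%N + c (2 ^ (j * D) - 2 ^ (i * D))%N) / 2
      <= a * a + eta.

Lemma circle_cosM (m n : nat) (x : R) : (n <= m)%N ->
  circle_cos m x * circle_cos n x = (circle_cos (m + n) x + circle_cos (m - n)
    x) / 2.
Proof.
move=> nm; rewrite /circle_cos natrD natrB//.
have -> : 2 * pi * (m%:R + n%:R) * x = 2 * pi * m%:R * x + 2 * pi * n%:R * x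
  by ring.
have -> : 2 * pi * (m%:R - n%:R) * x = 2 * pi * m%:R * x - 2 * pi * n%:R * x
  by ring.
by rewrite cosD cosB; field.
Qed.

Lemma bounded_measurable_circle_cos m :
  bounded_measurable (circle_cos m : measurableTypeR R -> R).
Proof.
by split; [exact: measurable_circle_cos|exists 1 => x; exact:
  circle_cos_norm_le1].
Qed.

Variable mu : probability (measurableTypeR R) R.

Lemma Rintegral_circle_cosM c (m n : nat) :
  (forall k, \int[mu]_x circle_cos k x = c k) ->
  (n <= m)%N -> \int[mu]_x (circle_cos m x * circle_cos n x) =
    (c (m + n)%N + c (m - n)%N) / 2.
Proof.
move=> ck nm; have b k := bounded_measurable_integrable mu
  (bounded_measurable_circle_cos k).
under eq_Rintegral => x _ do rewrite circle_cosM//.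
rewrite RintegralZr//; last first.
  apply: bounded_measurable_integrable.
  by apply: bounded_measurableD; exact: bounded_measurable_circle_cos.
by rewrite RintegralD// !ck.
Qed.

(** Among the [N] squared covariance terms, the [N] diagonal ones are at most [1 + eta] and the
    others at most [eta]; dividing by the square of [N] gives the bound. *)
Lemma frequency_variance c a eta N D :
  (forall k, \int[mu]_x circle_cos k x = c k) ->
  (forall k, c (2 ^ k)%N = a) -> (0 < N)%N -> 0 <= eta ->
  (forall i j, (i < j)%N ->
    (c (2 ^ (j * D) + 2 ^ (i * D))%N + c (2 ^ (j * D) - 2 ^ (i * D))%N) / 2
      <= a * a + eta) ->
  \int[mu]_x ((frequency N D x - a) * (frequency N D x - a)) <= N%:R^-1 + eta.
Proof.
move=> ck ca N0 eta0 ceta.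
have N0' : (0 : R) < N%:R by rewrite ltr0n.
pose u i : measurableTypeR R -> R := circle_cos (2 ^ (i * D)).
have bu i : bounded_measurable (u i) by exact: bounded_measurable_circle_cos.
have bua i : bounded_measurable (fun x => u i x - a).
  by apply: bounded_measurableD => //; exact: bounded_measurable_cst.
have E x : (frequency N D x - a) * (frequency N D x - a) =
    N%:R^-1 * N%:R^-1 * \sum_(i < N) \sum_(j < N) (u i x - a) * (u j x - a).
  have -> : frequency N D x - a = N%:R^-1 * \sum_(i < N) (u i x - a).
    rewrite sumrB big_const_ord iter_addr_0 -mulr_natr /frequency /u.
    by field; rewrite gt_eqF.
  by rewrite mulrACA big_distrlr.
have Iuu i j : \int[mu]_x ((u i x - a) * (u j x - a)) =
    \int[mu]_x (u i x * u j x) - a * a.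
  have -> : (fun x => (u i x - a) * (u j x - a)) =
      (fun x => u i x * u j x + ((- a) * (u i x + u j x) + a * a)).
    by apply/funext => x; ring.
  have b1 : bounded_measurable (fun x => u i x * u j x)
    by exact: bounded_measurableM.
  have b2 : bounded_measurable (fun x => u i x + u j x)
    by exact: bounded_measurableD.
  have b3 : bounded_measurable ((fun=> a * a) : measurableTypeR R -> R).
    exact: bounded_measurable_cst.
  have b4 : bounded_measurable (fun x => - a * (u i x + u j x)).
    by apply: bounded_measurableM => //; exact: bounded_measurable_cst.
  have int f (bf : bounded_measurable f) := bounded_measurable_integrable mu bf.
  rewrite RintegralD ?(int _ b1)//; last by apply: int; exact:
    bounded_measurableD.
  rewrite RintegralD ?(int _ b4) ?(int _ b3)// Rintegral_cst1.
  rewrite RintegralZl ?(int _ b2)// RintegralD ?(int _ (bu _))// !ck !ca.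
  by ring.
have le i j : \int[mu]_x ((u i x - a) * (u j x - a)) <= (i == j)%:R + eta.
  rewrite Iuu; case: (ltngtP i j) => [ij|ji|->] /=.
  - rewrite add0r lerBlDr addrC; under eq_Rintegral do rewrite mulrC.
    rewrite (Rintegral_circle_cosM ck); last by rewrite leq_exp2l//
      leq_mul2r ltnW// orbT.
    exact: ceta.
  - rewrite add0r lerBlDr addrC.
    rewrite (Rintegral_circle_cosM ck); last by rewrite leq_exp2l//
      leq_mul2r ltnW// orbT.
    exact: ceta.
  - have : \int[mu]_x (u j x * u j x) <= \int[mu]_x (1 : R).
      apply: le_Rintegral => //.
      + by apply: bounded_measurable_integrable; exact: bounded_measurableM.
      + by apply: bounded_measurable_integrable; exact: bounded_measurable_cst.
      move=> x _; rewrite -[leRHS](mul1r 1); apply: le_trans (ler_norm _) _.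
      by rewrite normrM ler_pM// circle_cos_norm_le1.
    by rewrite Rintegral_cst1 => h; have := sqr_ge0 a; rewrite expr2; lra.
under eq_Rintegral do rewrite E.
have bm i j : bounded_measurable (fun x => (u i x - a) * (u j x - a)).
  exact: bounded_measurableM.
rewrite RintegralZl//; last first.
  apply: bounded_measurable_integrable; apply: bounded_measurable_sum => i.
  by apply: bounded_measurable_sum => j.
rewrite Rintegral_bsum; last by move=> i; exact: bounded_measurable_sum.
apply: (@le_trans _ _ (N%:R^-1 * N%:R^-1 * \sum_(i < N) (1 + N%:R * eta))).
  rewrite ler_pM2l ?mulr_gt0 ?invr_gt0//; apply: ler_sum => i _.
  rewrite Rintegral_bsum//.
  apply: (@le_trans _ _ (\sum_(j < N) ((i == j)%:R + eta))).
    by apply: ler_sum => j _; exact: le.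
  rewrite big_split/= big_const_ord iter_addr_0 -[eta *+ N]mulr_natl lerD2r.
  rewrite (bigD1 i)//= eqxx big1 ?addr0// => j /negbTE.
  by rewrite eq_sym => ->.
rewrite big_const_ord iter_addr_0 -mulr_natr le_eqVlt; apply/orP; left;
  apply/eqP.
by field; rewrite gt_eqF.
Qed.

End Singularity.

(** * Separating set and application to the two walks *)

Section Conclusion.
Variable R : realType.
Implicit Types (mu nu : probability (measurableTypeR R) R) (c : nat -> R).
Implicit Types (a b : R).

Lemma bounded_measurable_frequency N D :
  bounded_measurable (frequency N D : measurableTypeR R -> R).
Proof.
apply: bounded_measurableM; last exact: bounded_measurable_cst.
by apply: bounded_measurable_sum => i; exact: bounded_measurable_circle_cos.
Qed.

Lemma frequency_concentration mu nu c c' a b (e : R) :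
  (forall k, \int[mu]_x circle_cos k x = c k) -> uncorrelated c a ->
  (forall k, \int[nu]_x circle_cos k x = c' k) -> uncorrelated c' b -> 0 < e ->
  exists f : measurableTypeR R -> R, [/\ bounded_measurable f,
    \int[mu]_x ((f x - a) * (f x - a)) <= e &
    \int[nu]_x ((f x - b) * (f x - b)) <= e].
Proof.
move=> ck [ca cm] c'k [c'b c'm] e0; have e20 : 0 < e / 2 by rewrite divr_gt0.
have [D1 D1P] := cm _ e20; have [D2 D2P] := c'm _ e20.
pose N := Num.bound (2 / e).
have Nlt : 2 / e < N%:R by apply: archi_boundP; rewrite ltW// divr_gt0.
have N0 : (0 < N)%N by rewrite -(ltr0n R); apply: lt_trans Nlt;
  rewrite divr_gt0.
have Ninv : N%:R^-1 + e / 2 <= e.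
  rewrite -lerBrDr (_ : e - e / 2 = (2 / e)^-1); last by field; rewrite gt_eqF.
  by rewrite lef_pV2 ?posrE ?ltr0n// ?divr_gt0// ltW.
(* The same function is tested against both measures, so one spacing has to serve both. *)
exists (frequency N (maxn D1 D2)); split; first exact:
  bounded_measurable_frequency.
- apply: le_trans Ninv; apply: (frequency_variance ck ca N0 (ltW e20)) =>
    i j ij.
  by apply: D1P => //; exact: leq_maxl.
- apply: le_trans Ninv; apply: (frequency_variance c'k c'b N0 (ltW e20)) =>
    i j ij.
  by apply: D2P => //; exact: leq_maxr.
Qed.

Lemma borel_cantelli_half mu (F : nat -> set (measurableTypeR R)) :
  (forall n, measurable (F n)) ->
  (forall n, (mu (F n) <= (1 / (2 ^ (n + 1))%:R)%:E)%E) ->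
  mu (lim_sup_set F) = 0%E.
Proof.
move=> mF muF; apply: lim_sup_set_cvg0 => //.
apply: (@le_lt_trans _ _ 1%E); last exact: ltry.
have := @cvg_geometric_eseries_half R 1 0; rewrite expr0 divr1 => c.
rewrite -(cvg_lim _ c)//; apply: lee_nneseries => // n _; exact: muF.
Qed.

Lemma uncorrelated_singular mu nu c c' a b :
  (forall k, \int[mu]_x circle_cos k x = c k) -> uncorrelated c a ->
  (forall k, \int[nu]_x circle_cos k x = c' k) -> uncorrelated c' b -> a != b ->
  mutually_singular mu nu.
Proof.
move=> ck ca c'k c'b ab.
pose delta := `|a - b| / 2.
have d0 : 0 < delta by rewrite divr_gt0// normr_gt0 subr_eq0.
(* The factor [delta * delta] is what Chebyshev's inequality divides by, leaving the summable bound
   2^-(n+1). *)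
have e0 n : 0 < delta * delta * (1 / (2 ^ (n + 1))%:R).
  apply: mulr_gt0; first exact: mulr_gt0.
  by rewrite divr_gt0// ltr0n expn_gt0.
have [f fP] := choice (fun n => frequency_concentration ck ca c'k c'b (e0 n)).
pose F n := [set x | delta <= `|f n x - a|].
pose F' n := [set x | delta <= `|f n x - b|].
have bm s n : bounded_measurable (fun x => f n x - s).
  have [bf _ _] := fP n.
  by apply: bounded_measurableD => //; exact: bounded_measurable_cst.
have mF s n : measurable [set x : measurableTypeR R | delta <= `|f n x - s|].
  have [m _] := bm s n.
  rewrite (_ : [set _ | _] = (fun x => `|f n x - s|) @^-1` `[delta, +oo[).
    by rewrite -[_ @^-1` _]setTI; apply: (measurableT_comp _ m).
  by apply/seteqP; split => x /=; rewrite in_itv/= andbT.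
have muF n : (mu (F n) <= (1 / (2 ^ (n + 1))%:R)%:E)%E.
  by have [_ H _] := fP n; exact: (chebyshev_bound (bm a n) d0 H).
have nuF n : (nu (F' n) <= (1 / (2 ^ (n + 1))%:R)%:E)%E.
  by have [_ _ H] := fP n; exact: (chebyshev_bound (bm b n) d0 H).
have mls (H : nat -> set (measurableTypeR R)) : (forall n, measurable (H n)) ->
    measurable (lim_sup_set H).
  by move=> mH; apply: bigcap_measurableType => k _; apply: bigcup_measurable.
exists (lim_sup_set F); split.
- exact: mls (mF a).
- exact: borel_cantelli_half (mF a) muF.
(* Since [delta] is half the distance from [a] to [b], a value within [delta] of [a] is at least
   [delta] away from [b]. *)
have sub : ~` lim_sup_set F `<=` lim_sup_set F'.
  move=> x nx n _.
  have [k kx] : exists k, forall j, (k <= j)%N -> ~ F j x.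
    apply: contrapT => H; apply: nx => k _; apply: contrapT => H'; apply: H.
    by exists k => j kj Fj; apply: H'; exists j.
  exists (maxn n k); first by rewrite /= leq_maxl.
  have /negP := kx _ (leq_maxr n k); rewrite -ltNge => lt.
  rewrite /F' /=.
  have : `|a - b| <= `|f (maxn n k) x - a| + `|f (maxn n k) x - b|.
    rewrite [X in _ <= X + _]distrC.
    by rewrite (le_trans _ (ler_normD _ _))// addrA subrK.
  by move: lt; rewrite /delta; lra.
apply/eqP; rewrite eq_le measure_ge0 andbT.
rewrite -(borel_cantelli_half (mF b) nuF); apply: le_measure => //.
- by rewrite inE; apply: measurableC; exact: mls (mF a).
- by rewrite inE; exact: mls (mF b).
Qed.

Lemma uncorrelated_fourier_Gamma : uncorrelated (@fourier_Gamma R)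
  (fourier_Gamma R 1).
Proof.
split=> [k|eta eta0]; first by rewrite -[(2 ^ k)%N]muln1 fourier_Gamma_expn.
have cp : (fun d => fourier_Gamma R (2 ^ d + 1)) @ \oo -->
  fourier_Gamma R 1 * fourier_Gamma R 1.
  by apply: (@fourier_Gamma_mixing R _ 1) => [|d]; [left|rewrite natrD natrX].
have cn : (fun d => fourier_Gamma R (2 ^ d - 1)) @ \oo -->
  fourier_Gamma R 1 * fourier_Gamma R 1.
  apply: (@fourier_Gamma_mixing R _ (-1)) => [|d]; first by right.
  by rewrite natrB ?expn_gt0// natrX.
have lt : fourier_Gamma R 1 * fourier_Gamma R 1 < fourier_Gamma R 1 *
  fourier_Gamma R 1 + eta by rewrite ltrDl.
have [Dp _ DpP] := cvgr_le _ cp _ lt; have [Dn _ DnP] := cvgr_le _ cn _ lt.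
exists (maxn 1 (maxn Dp Dn)) => D; rewrite !geq_max =>
  /and3P[D1 DDp DDn] i j ij.
have De : (D <= (j - i) * D)%N by rewrite leq_pmull// subn_gt0.
(* The common factor [2 ^ (i * D)] does not change the coefficient; what remains is [2 ^ e + 1] and
   [2 ^ e - 1] with [e] at least [D]. *)
have -> : (2 ^ (j * D) = 2 ^ (i * D) * 2 ^ ((j - i) * D))%N.
  by rewrite -expnD -mulnDl subnKC// ltnW.
set e := ((j - i) * D)%N; set p := (2 ^ (i * D))%N.
have -> : (p * 2 ^ e + p = p * (2 ^ e + 1))%N by rewrite mulnDr muln1.
have -> : (p * 2 ^ e - p = p * (2 ^ e - 1))%N by rewrite mulnBr muln1.
rewrite !fourier_Gamma_expn.
have := DpP _ (leq_trans DDp De); have := DnP _ (leq_trans DDn De).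
by rewrite /=; lra.
Qed.

Lemma uncorrelated_eq0 c : (forall k, (0 < k)%N -> c k = 0) -> uncorrelated c 0.
Proof.
move=> c0; split=> [k|eta eta0]; first by rewrite c0// expn_gt0.
(* A positive spacing keeps the difference frequency positive. *)
exists 1%N => D D0 i j ij; rewrite !c0 ?addn_gt0 ?expn_gt0//.
  by lra.
by rewrite subn_gt0 ltn_exp2l// ltn_pmul2r.
Qed.

End Conclusion.

Theorem proposition4p18 (R : realType)
    (nu_h nu_h_dual : probability (measurableTypeR R) R) :
  harmonic_measure Gamma nu_h ->
  harmonic_measure Gamma_dual nu_h_dual ->
  mutually_singular nu_h nu_h_dual.
Proof.
move=> harm harm_dual.
apply: (@uncorrelated_singular _ nu_h nu_h_dual (@fourier_Gamma R)
  (fun k => \int[nu_h_dual]_x circle_cos k x) (fourier_Gamma R 1) 0) => //.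
- move=> k; rewrite /Rintegral.
  by rewrite (harmonic_measure_fourier size_Gamma harm
    (@walk_mean_Gamma_cvg R k)).
- exact: uncorrelated_fourier_Gamma.
- apply: uncorrelated_eq0 => k k0; rewrite /Rintegral.
  by rewrite (harmonic_measure_fourier size_Gamma_dual harm_dual
    (@walk_mean_Gamma_dual_cvg0 R k k0)).
- by rewrite gt_eqF// fourier_Gamma1_gt0.
Qed.
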